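(* Let $f:\mathbb{R}^d\to\mathbb{R}$ be twice differentiable, $L$-smooth, $\sigma$-strongly convex, and with $\gamma$-Lipschitz Hessian. Let $(\hat\mu_*,\hat\Sigma_* )$ be the minimizer of $Q_\alpha(\mu,\Sigma)$ over $\mu\in\mathbb{R}^d$ under the constraint $\Sigma\in\mathcal{S}$. Let $\mu_*$ be the minimizer of $f$, and let $\Sigma_*$ be the minimizer of $\Sigma\mapsto Q_\alpha(\mu_*,\Sigma)$ under the constraint $\Sigma\in\mathcal{S}$. Assume that $$\alpha\le\frac{3\tau^{3/2}\sigma}{\gamma\zeta}\cdot\left(\left(d^3+6d^2+8d\right)^{5/6}+d\left(d^2+2d\right)^{3/4}\right)^{-1}.$$ Then $$\left\|\hat\Sigma_*-\Pi_{\mathcal{S}}\left(\left(\nabla^2 f(\hat\mu_* )\right)^{-1}\right)\right\|\le\frac{\alpha\gamma\zeta}{3\tau^{3/2}\sigma^2}\cdot\left(\left(d^3+6d^2+8d\right)^{5/6}+d\left(d^2+2d\right)^{3/4}\right)$$ and $$\begin{aligned}\left\|\Sigma_*-\hat\Sigma_*\right\|\le\ &\frac{2\alpha\gamma\zeta}{3\tau^{3/2}\sigma^2}\cdot\left(\left(d^3+6d^2+8d\right)^{5/6}+d\left(d^2+2d\right)^{3/4}\right)\\&+\frac{\gamma}{\sigma^2}\cdot\left(\frac{2dL\alpha^2}{\sigma\tau}+\frac{2\gamma\alpha^3(d^2+2d)^{3/4}}{3\sigma\tau^{3/2}}+\frac{d\alpha^2}{\sigma}\left(\tau^{-1}-\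zeta^{-1}\right)\right)^{1/2}.\end{aligned}$$
   Context: Fix constants $\alpha>0$ and $0<\tau\le\zeta$. For $\mu\in\mathbb{R}^d$ and symmetric positive definite $\Sigma$, define $$Q_\alpha(\mu,\Sigma)=\mathbb{E}_{u\sim N(0,I_d)}\left[f(\mu+\alpha\Sigma^{1/2}u)\right]-\frac{\alpha^2}{2}\log\det\Sigma .$$ $\mathcal{S}=\{\Sigma \text{ symmetric } d\times d:\ \zeta^{-1}I\preceq\Sigma\preceq\tau^{-1}I\}$, and for symmetric $A$, $\Pi_{\mathcal{S}}(A)=\operatorname*{arg\,min}_{X\in\mathcal{S}}\|A-X\|$ (Frobenius norm). $f$ is $L$-smooth if $\|\nabla f(\mu_1)-\nabla f(\mu_2)\|\le L\|\mu_1-\mu_2\|$; $\sigma$-strongly convex if $f(\mu_1)-f(\mu_2)\ge\langle\nabla f(\mu_2),\mu_1-\mu_2\rangle+\frac{\sigma}{2}\|\mu_1-\mu_2\|^2$; and has $\gamma$-Lipschitz Hessian if $\|\nabla^2 f(\mu_1)-\nabla^2 f(\mu_2)\|\le\gamma\|\mu_1-\mu_2\|$; each for all $\mu_1,\mu_2\in\mathbb{R}^d$. Here $\|\cdot\|$ is the Euclidean norm on vectors and the Frobenius norm on matrices. *)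

(* Defs.v *)
(* Vectors of R^d are row vectors, as in the library treatment of jacobians. *)
From HB Require Import structures.
From mathcomp Require Import all_boot all_order all_algebra.
From mathcomp Require Import all_classical all_reals all_analysis.

Set Implicit Arguments.
Unset Strict Implicit.
Unset Printing Implicit Defensive.

Import Order.TTheory GRing.Theory Num.Theory.
Import numFieldNormedType.Exports.

Local Open Scope classical_set_scope.
Local Open Scope ring_scope.

Definition minimizer {R : realType} {T : Type} (A : set T) (F : T -> R) : set T :=
  [set x | A x /\ forall y, A y -> F x <= F y].

Section StandardGaussian.
Context {R : realType}.

Definition cons_pair n (x : measurableTypeR R * n.-tuple (measurableTypeR R)) :
    n.+1.-tuple (measurableTypeR R) :=
  [tuple of x.1 :: x.2].

Lemma measurable_cons_pair n : measurable_fun setT (@cons_pair n).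
Proof. exact: measurable_cons. Qed.

HB.instance Definition _ n :=
  isMeasurableFun.Build _ _ _ _ (@cons_pair n) (@measurable_cons_pair n).

(* The law N(0, I_d) on R^d, i.e. the d-fold product of N(0, 1). *)
Fixpoint std_gaussian d : probability (d.-tuple (measurableTypeR R)) R :=
  match d with
  | 0 => [the probability _ R of dirac [tuple]]
  | n.+1 => [the probability _ R of
      distribution (normal_prob 0%R 1%R \x std_gaussian n)%E (@cons_pair n)]
  end.

Definition vec_of_tuple d (u : d.-tuple R) : 'rV[R]_d := \row_i tnth u i.

End StandardGaussian.
Arguments std_gaussian R d : clear implicits.

Section Matrices.
Context {R : realType}.

(* The norm `|A| of the library is the max norm. For row vectors, the Frobenius
   norm is the Euclidean norm. *)
Definition frob m n (A : 'M[R]_(m, n)) : R :=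
  Num.sqrt (\sum_i \sum_j A i j ^+ 2).

Definition dotv d (x y : 'rV[R]_d) : R := (x *m y^T) 0 0.

Definition psdmx d (A : 'M[R]_d) : Prop :=
  A^T = A /\ forall x : 'rV[R]_d, 0 <= dotv (x *m A) x.

Definition loewner_le d (A B : 'M[R]_d) : Prop := psdmx (B - A).

(* A positive semidefinite A has exactly one positive semidefinite square root;
   the value on other matrices is irrelevant. *)
Definition sqrtmx d (A : 'M[R]_d) : 'M[R]_d :=
  xget 0 [set B | psdmx B /\ B *m B = A].

Definition cov_set d (tau zeta : R) : set 'M[R]_d :=
  [set S | [/\ S^T = S, loewner_le (zeta^-1)%:M S & loewner_le S (tau^-1)%:M]].

(* cov_set is closed and convex, so the minimizer exists and is unique as soon
   as 0 < tau <= zeta. *)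
Definition proj_cov d (tau zeta : R) (A : 'M[R]_d) : 'M[R]_d :=
  xget 0 (minimizer (cov_set tau zeta) (fun X => frob (A - X))).

End Matrices.

Section Calculus.
Context {R : realType} {d : nat}.
Implicit Types f : 'rV[R]_d -> R.

Definition gradient f (x : 'rV[R]_d) : 'rV[R]_d :=
  \row_j 'D_(delta_mx 0 j) f x.

Definition hessian f (x : 'rV[R]_d) : 'M[R]_d := 'J (gradient f) x.

Definition twice_differentiable f : Prop :=
  (forall x, differentiable f x) /\ (forall x, differentiable (gradient f) x).

Definition smooth (L : R) f : Prop :=
  forall x y, frob (gradient f x - gradient f y) <= L * frob (x - y).

Definition strongly_convex (sigma : R) f : Prop :=
  forall x y, f x - f y >=
    dotv (gradient f y) (x - y) + sigma / 2 * frob (x - y) ^+ 2.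

Definition lipschitz_hessian (gamma : R) f : Prop :=
  forall x y, frob (hessian f x - hessian f y) <= gamma * frob (x - y).

End Calculus.

(* Since vectors are rows, Sigma^(1/2) u reads u *m sqrtmx Sigma. *)
Definition Qalpha {R : realType} d (f : 'rV[R]_d -> R) (alpha : R)
    (mu : 'rV[R]_d) (Sigma : 'M[R]_d) : R :=
  fine 'E_(std_gaussian R d)[fun u =>
    (f (mu + alpha *: (vec_of_tuple u *m sqrtmx Sigma)))%R]%E
  - alpha ^+ 2 / 2 * ln (\det Sigma).

Definition dim_const {R : realType} (d : nat) : R :=
  (d%:R ^+ 3 + 6 * d%:R ^+ 2 + 8 * d%:R) `^ (5 / 6)
  + d%:R * (d%:R ^+ 2 + 2 * d%:R) `^ (3 / 4).

(* Main.v *)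
(* Everything is expressed through the square roots B of the covariances.  For fixed mu the
   objective E f(mu + alpha B u) - alpha^2 ln det B is, up to f(mu), the explicit function
   alpha^2 (tr(B H B) / 2 - ln det B) with H = hess f(mu), plus a remainder r(B).  The Hessian
   being gamma-Lipschitz, r is Lipschitz in B with constant of order gamma alpha^3; no
   differentiation under the expectation is needed, only E |u|^2 = d and E |u|^4 <= d^2 + 2d.
   The explicit part, diagonalised along H, is minimised over the feasible set at the square
   root of the matrix whose eigenvalues are those of H^-1 clipped to [1/zeta, 1/tau], which is
   exactly the projection of H^-1, and it grows there at least like sigma/2 |M|^2, plus a term
   linear in |M| when sigma > zeta.  Comparing the values at both points bounds the distance.

   The second estimate adds the nonexpansiveness of the projection and the bound on
   |muhat - mustar| obtained by comparing the objective at (muhat, Sigmahat) and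
   (mustar, Sigmahat), where the log-determinants cancel. *)
Require Import Defs.
From mathcomp Require Import all_boot all_order all_algebra.
From mathcomp Require Import all_classical all_reals all_analysis.
From mathcomp Require Import measurable_realfun.
From mathcomp Require Import ring lra.
Import Order.TTheory GRing.Theory Num.Theory.
Import numFieldNormedType.Exports.
Local Open Scope classical_set_scope.
Local Open Scope ring_scope.

Set Implicit Arguments.
Unset Strict Implicit.
Unset Printing Implicit Defensive.

(** * Frobenius inner product *)

(** The integrand is f(mu + alpha u B), so the root B enters linearly, and covariances with roots B
    and C are compared along the single displacement alpha u M, M = B - C. In the variable B the
    model is convex with a clean modulus: -ln det B lies above its tangents, hence tr(B H B) / 2
    keeps its full curvature sigma, independent of tau and zeta. Returning to covariances costs 2 /
    sqrt tau, the Lipschitz constant of squaring. The obstacle is the factor zeta / sigma^2 of the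
    first bound. Growth sigma/2 |M|^2 alone yields a factor 1 / sigma, which suffices when sigma <=
    zeta. When sigma > zeta, all eigenvalues of H^-1 are below 1/zeta, the projection is the corner
    I / zeta of the feasible set, and the model has a nonzero slope there; this slope and the
    hypothesis on alpha recover the missing factor. *)

Definition mxdot {R : realType} {m n : nat} (A B : 'M[R]_(m, n)) : R :=
  \tr (A *m B^T).

Section Frobenius.
Context {R : realType}.
Implicit Types m n : nat.

Lemma mxdotE m n (A B : 'M[R]_(m, n)) : mxdot A B = \sum_i \sum_j A i j * B i j.
Proof.
apply: eq_bigr => i _; rewrite mxE; apply: eq_bigr => j _.
by rewrite mxE.
Qed.

Lemma dotvE n (x y : 'rV[R]_n) : dotv x y = mxdot x y.
Proof. by rewrite /mxdot [\tr _]trace_mx11. Qed.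

Lemma mxdotC m n (A B : 'M[R]_(m, n)) : mxdot A B = mxdot B A.
Proof. by rewrite /mxdot -mxtrace_tr trmx_mul trmxK. Qed.

Lemma mxdotDl m n (A B C : 'M[R]_(m, n)) : mxdot (A + B) C = mxdot A C + mxdot B C.
Proof. by rewrite /mxdot mulmxDl mxtraceD. Qed.

Lemma mxdotDr m n (A B C : 'M[R]_(m, n)) : mxdot A (B + C) = mxdot A B + mxdot A C.
Proof. by rewrite mxdotC mxdotDl !(mxdotC A). Qed.

Lemma mxdotZl m n (a : R) (A B : 'M[R]_(m, n)) : mxdot (a *: A) B = a * mxdot A B.
Proof. by rewrite /mxdot -scalemxAl mxtraceZ. Qed.

Lemma mxdotZr m n (a : R) (A B : 'M[R]_(m, n)) : mxdot A (a *: B) = a * mxdot A B.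
Proof. by rewrite mxdotC mxdotZl mxdotC. Qed.

Lemma mxdotNl m n (A B : 'M[R]_(m, n)) : mxdot (- A) B = - mxdot A B.
Proof. by rewrite -scaleN1r mxdotZl mulN1r. Qed.

Lemma mxdotNr m n (A B : 'M[R]_(m, n)) : mxdot A (- B) = - mxdot A B.
Proof. by rewrite mxdotC mxdotNl mxdotC. Qed.

Lemma mxdot0l m n (A : 'M[R]_(m, n)) : mxdot 0 A = 0.
Proof. by rewrite -(scale0r A) mxdotZl mul0r. Qed.

Lemma mxdot0r m n (A : 'M[R]_(m, n)) : mxdot A 0 = 0.
Proof. by rewrite mxdotC mxdot0l. Qed.

Lemma mxdot_mull m n p (A : 'M[R]_(m, n)) (B : 'M[R]_(n, p)) C :
  mxdot (A *m B) C = mxdot A (C *m B^T).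
Proof. by rewrite /mxdot trmx_mul trmxK mulmxA. Qed.

Lemma mxdot_mulr m n p (A : 'M[R]_(m, n)) (B : 'M[R]_(n, p)) C :
  mxdot (A *m B) C = mxdot B (A^T *m C).
Proof. by rewrite /mxdot trmx_mul trmxK [LHS]mxtrace_mulC !mulmxA mxtrace_mulC mulmxA. Qed.

Lemma mxdot_tr m n (A B : 'M[R]_(m, n)) : mxdot A^T B^T = mxdot A B.
Proof. by rewrite /mxdot trmxK mxtrace_mulC -mxtrace_tr trmx_mul trmxK. Qed.

Lemma mxdot_ge0 m n (A : 'M[R]_(m, n)) : 0 <= mxdot A A.
Proof.
by rewrite mxdotE; do 2 apply: sumr_ge0 => ? _; rewrite -expr2 sqr_ge0.
Qed.

Lemma frob_ge0 m n (A : 'M[R]_(m, n)) : 0 <= frob A.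
Proof. exact: sqrtr_ge0. Qed.

Lemma frob_sqr m n (A : 'M[R]_(m, n)) : frob A ^+ 2 = mxdot A A.
Proof.
have -> : mxdot A A = \sum_i \sum_j A i j ^+ 2 by rewrite mxdotE.
by rewrite sqr_sqrtr//; do 2 apply: sumr_ge0 => ? _; rewrite sqr_ge0.
Qed.

Lemma frobE m n (A : 'M[R]_(m, n)) : frob A = Num.sqrt (mxdot A A).
Proof. by rewrite -frob_sqr sqrtr_sqr ger0_norm// frob_ge0. Qed.

Lemma mxdot_eq0 m n (A : 'M[R]_(m, n)) : (mxdot A A == 0) = (A == 0).
Proof.
apply/idP/eqP => [|->]; last by rewrite mxdot0l.
rewrite mxdotE psumr_eq0 => [/allP h|i _]; last first.
  by apply: sumr_ge0 => j _; rewrite -expr2 sqr_ge0.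
apply/matrixP => i j; rewrite mxE.
have := h i (mem_index_enum _).
rewrite psumr_eq0 => [/allP /(_ j (mem_index_enum _))|k _]; last first.
  by rewrite -expr2 sqr_ge0.
by rewrite /= -expr2 sqrf_eq0 => /eqP.
Qed.

Lemma frob_eq0 m n (A : 'M[R]_(m, n)) : (frob A == 0) = (A == 0).
Proof. by rewrite -sqrf_eq0 frob_sqr mxdot_eq0. Qed.

Lemma frob0 m n : frob (0 : 'M[R]_(m, n)) = 0.
Proof. by apply/eqP; rewrite frob_eq0. Qed.

Lemma mxdot_le_sqr m n (A B : 'M[R]_(m, n)) :
  mxdot A B ^+ 2 <= mxdot A A * mxdot B B.
Proof.
have [->|B0] := eqVneq B 0; first by rewrite !mxdot0r expr0n mulr0.
have b0 : 0 < mxdot B B by rewrite lt_neqAle mxdot_ge0 andbT eq_sym mxdot_eq0.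
have := mxdot_ge0 (mxdot B B *: A - mxdot A B *: B).
rewrite mxdotDl !mxdotDr !mxdotNl !mxdotNr !mxdotZl !mxdotZr (mxdotC B A).
move: b0; set a := mxdot A A; set b := mxdot B B; set c := mxdot A B => b0 h.
rewrite -subr_ge0 -(pmulr_rge0 _ b0).
by apply: le_trans h _; rewrite le_eqVlt; apply/orP; left; apply/eqP; ring.
Qed.

Lemma mxdot_le m n (A B : 'M[R]_(m, n)) : `|mxdot A B| <= frob A * frob B.
Proof.
rewrite -ler_sqr ?nnegrE ?mulr_ge0 ?frob_ge0//.
by rewrite real_normK ?num_real// exprMn !frob_sqr mxdot_le_sqr.
Qed.

Lemma mxdot_ler m n (A B : 'M[R]_(m, n)) : mxdot A B <= frob A * frob B.
Proof. by apply: le_trans (mxdot_le _ _); exact: ler_norm. Qed.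

Lemma frobD m n (A B : 'M[R]_(m, n)) : frob (A + B) <= frob A + frob B.
Proof.
rewrite -ler_sqr ?nnegrE ?addr_ge0 ?frob_ge0//.
rewrite sqrrD !frob_sqr mxdotDl !mxdotDr (mxdotC B A).
by have := mxdot_ler A B; lra.
Qed.

Lemma frobZ m n (a : R) (A : 'M[R]_(m, n)) : frob (a *: A) = `|a| * frob A.
Proof.
by rewrite !frobE mxdotZl mxdotZr mulrA -expr2 sqrtrM ?sqr_ge0// sqrtr_sqr.
Qed.

Lemma frobN m n (A : 'M[R]_(m, n)) : frob (- A) = frob A.
Proof. by rewrite -scaleN1r frobZ normrN1 mul1r. Qed.

Lemma frobBC m n (A B : 'M[R]_(m, n)) : frob (A - B) = frob (B - A).
Proof. by rewrite -opprB frobN. Qed.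

Lemma frob_tr m n (A : 'M[R]_(m, n)) : frob A^T = frob A.
Proof. by rewrite !frobE mxdot_tr. Qed.

Lemma frobM m n p (A : 'M[R]_(m, n)) (B : 'M[R]_(n, p)) :
  frob (A *m B) <= frob A * frob B.
Proof.
rewrite -ler_sqr ?nnegrE ?mulr_ge0 ?frob_ge0// exprMn !frob_sqr.
have eqB : mxdot B B = \sum_k mxdot (row k B^T) (row k B^T).
  rewrite -mxdot_tr mxdotE; apply: eq_bigr => k _.
  by rewrite mxdotE big_ord1; apply: eq_bigr => l _; rewrite !mxE.
have eqA : mxdot A A = \sum_i mxdot (row i A) (row i A).
  rewrite mxdotE; apply: eq_bigr => k _.
  by rewrite mxdotE big_ord1; apply: eq_bigr => l _; rewrite !mxE.
rewrite eqA eqB mulr_suml mxdotE; apply: ler_sum => i _.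
rewrite mulr_sumr; apply: ler_sum => k _.
apply: le_trans (mxdot_le_sqr _ _); rewrite -expr2 le_eqVlt; apply/orP; left.
apply/eqP; congr (_ ^+ 2); rewrite mxdotE big_ord1 mxE.
by apply: eq_bigr => j _; rewrite !mxE.
Qed.

Lemma row_frob_sqr_le_frobM n p (x : 'rV[R]_n) (B : 'M[R]_(n, p)) :
  mxdot (x *m B) (x *m B) <= mxdot x x * mxdot B B.
Proof.
rewrite -!frob_sqr -exprMn ler_sqr ?nnegrE ?mulr_ge0 ?frob_ge0//.
exact: frobM.
Qed.

End Frobenius.

(** * Spectral theorem for real symmetric matrices *)

Section Spectral.
Context {R : realType}.
Implicit Types n : nat.

(** Stands in for letting t tend to 0 after dividing an inequality by t. If p > 0, the t tested
    below lies in ]0, 1[ and makes t q smaller than p. *)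
Lemma le0_linear_bound (p q : R) : (forall t, 0 < t < 1 -> p <= t * q) -> p <= 0.
Proof.
move=> h; rewrite leNgt; apply/negP => p0.
have q0 : 0 < `|q| + 1 by rewrite ltr_wpDl.
have den0 : 0 < p + 2 * (`|q| + 1) by rewrite addr_gt0 ?mulr_gt0.
have := h (p / (p + 2 * (`|q| + 1))).
rewrite divr_gt0//= ltr_pdivrMr// mul1r ltrDl mulr_gt0// => /(_ isT).
rewrite mulrAC ler_pdivlMr// ler_pM2l//.
by have := ler_norm q; lra.
Qed.

Lemma continuous_sum_fun (T : topologicalType) (I : Type) (r : seq I)
    (F : I -> T -> R) :
  (forall i, continuous (F i)) -> continuous (fun x => \sum_(i <- r) F i x).
Proof.
move=> cF; elim: r => [|i r IH].
  by rewrite (_ : (fun _ => _) = cst 0) ?funeqE// => x; [exact: cvg_cst|rewrite big_nil].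
rewrite (_ : (fun _ => _) = (fun x => F i x + \sum_(j <- r) F j x)); last first.
  by apply/funext => x; rewrite big_cons.
by move=> x; apply: cvgD; [exact: cF|exact: IH].
Qed.

Lemma continuous_rowM n m (A : 'M[R]_(n, m)) (j : 'I_m) :
  continuous (fun x : 'rV[R]_n => (x *m A) 0 j).
Proof.
rewrite (_ : (fun _ => _) = (fun x : 'rV[R]_n => \sum_i x 0 i * A i j)); last first.
  by apply/funext => x; rewrite mxE.
apply: continuous_sum_fun => i x; apply: (@continuousM _ _ _ (cst (A i j))).
  exact: coord_continuous.
exact: cst_continuous.
Qed.

Lemma continuous_quadratic n (A : 'M[R]_n) :
  continuous (fun x : 'rV[R]_n => mxdot (x *m A) x).
Proof.
rewrite (_ : (fun _ => _) =
    (fun x : 'rV[R]_n => \sum_j (x *m A) 0 j * x 0 j)); last first.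
  by apply/funext => x; rewrite mxdotE big_ord1.
apply: continuous_sum_fun => j x.
by apply: continuousM; [exact: continuous_rowM|exact: coord_continuous].
Qed.

Lemma mxdot_coord_le n (x : 'rV[R]_n) i : x 0 i ^+ 2 <= mxdot x x.
Proof.
rewrite mxdotE big_ord1 (bigD1 i)//= -expr2 lerDl.
by apply: sumr_ge0 => j _; rewrite -expr2 sqr_ge0.
Qed.

(* The maximiser of the Rayleigh quotient on the unit sphere. *)
Lemma symmetric_eigenvector n (A : 'M[R]_n.+1) : A^T = A ->
  exists x : 'rV_n.+1, exists a, mxdot x x = 1 /\ x *m A = a *: x.
Proof.
move=> Asym; pose S := [set x : 'rV[R]_n.+1 | mxdot x x = 1].
pose F := fun x : 'rV[R]_n.+1 => mxdot (x *m A) x.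
have S0 : S !=set0.
  exists (delta_mx 0 0); rewrite /S/= /mxdot trmx_delta mul_delta_mx.
  by rewrite trace_mx11 mxE.
have cS : compact S.
  apply: bounded_closed_compact.
    exists 1; split => // M M1 x /= x1.
    apply: le_trans (ltW M1); rewrite /Num.norm /= mx_normrE.
    apply/bigmax_leP; split => //= -[i j] _ /=; rewrite ord1.
    rewrite -(@ler_pXn2r _ 2) ?nnegrE// expr1n real_normK ?num_real//.
    by rewrite -x1 mxdot_coord_le.
  rewrite (_ : S = (fun x : 'rV[R]_n.+1 => mxdot (x *m 1%:M) x) @^-1` [set 1]).
    apply: closed_comp => [x _|]; [exact: continuous_quadratic|exact: closed_eq].
  by apply/seteqP; split => x /=; rewrite mulmx1.
have [x xS xmax] := @EVT_max_rV R n.+1 F S S0 cS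
  (continuous_subspaceT (@continuous_quadratic _ A)).
exists x, (F x); split; first exact: set_mem.
move: xS => /set_mem /= xS; set a := F x.
have q_ge0 (y : 'rV[R]_n.+1) : 0 <= a * mxdot y y - mxdot (y *m A) y.
  have [->|y0] := eqVneq y 0; first by rewrite mxdot0r mulr0 mxdot0r subr0.
  have ny0 : frob y != 0 by rewrite frob_eq0.
  have := xmax ((frob y)^-1 *: y).
  rewrite inE /F /S/= -scalemxAl !mxdotZl !mxdotZr -frob_sqr => /(_ _).
  rewrite expr2 mulKf// mulVf// => /(_ erefl); rewrite -/(F x) -/a mulrA -invfM => h.
  have n2 : 0 < frob y * frob y by rewrite -expr2 exprn_gt0// lt_neqAle eq_sym ny0 frob_ge0.
  by rewrite subr_ge0 mulrC -ler_pdivrMl.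
have [w wE] : exists w, x *m A = w + a *: x by exists (x *m A - a *: x); rewrite subrK.
suff /eqP : mxdot w w == 0 by move/eqP; rewrite mxdot_eq0 wE => /eqP->; rewrite add0r.
(* The form of [q_ge0] is nonnegative and vanishes at [x], so its derivative in the direction [w]
   cannot be negative; that derivative is -2 |w|^2. *)
have key t : 0 <= t ^+ 2 * (a * mxdot w w - mxdot (w *m A) w) - 2 * t * mxdot w w.
  have := q_ge0 (x + t *: w).
  rewrite mulmxDl -scalemxAl !mxdotDl !mxdotDr !mxdotZl !mxdotZr xS.
  rewrite (mxdotC w x) -/(F x) -/a (mxdot_mull w) Asym.
  rewrite (mxdotC w (x *m A)) wE !mxdotDl !mxdotZl.
  set p := mxdot w w; set q := mxdot (w *m A) w.
  set r := mxdot x w => h.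
  by apply: le_trans h _; rewrite le_eqVlt; apply/orP; left; apply/eqP; ring.
rewrite eq_le mxdot_ge0 andbT.
apply: (@le0_linear_bound _ (2^-1 * (a * mxdot w w - mxdot (w *m A) w))) => t /andP[t0 _].
have := key t; set q := _ - mxdot _ _ => h.
rewrite -(ler_pM2l t0) -subr_ge0 -(@pmulr_rge0 _ 2)//.
by apply: le_trans h _; rewrite le_eqVlt; apply/orP; left; apply/eqP; field.
Qed.

(* [1 - 2 v^T v / |v|^2] with [v = x - e_0] is the reflection exchanging [e_0]
   and [x]. *)
Lemma orthogonal_completion n (x : 'rV[R]_n.+1) : mxdot x x = 1 ->
  exists2 U : 'M[R]_n.+1, U *m U^T = 1%:M & delta_mx 0 0 *m U = x.
Proof.
move=> x1; pose e : 'rV[R]_n.+1 := delta_mx 0 0; pose v := x - e.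
have e1 : mxdot e e = 1.
  by rewrite /mxdot trmx_delta mul_delta_mx trace_mx11 mxE.
have [v0|v0] := eqVneq v 0.
  exists 1%:M; first by rewrite trmx1 mulmx1.
  by rewrite mulmx1; apply/eqP; rewrite eq_sym -subr_eq0; apply/eqP.
have vv0 : mxdot v v != 0 by rewrite mxdot_eq0.
pose k := 2 / mxdot v v.
have vvE : v *m v^T = (mxdot v v)%:M by rewrite [LHS]mx11_scalar -dotvE.
have vv : mxdot v v = 2 - 2 * mxdot x e.
  by rewrite /v !mxdotDl !mxdotDr !mxdotNl !mxdotNr x1 e1 (mxdotC e); lra.
have ev : mxdot e v = mxdot x e - 1 by rewrite mxdotDr mxdotNr e1 mxdotC.
pose U : 'M[R]_n.+1 := 1%:M - k *: (v^T *m v).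
have UT : U^T = U.
  by rewrite /U [LHS]linearB/= trmx1 [X in _ - X]linearZ/= trmx_mul trmxK.
have mulU (y : 'rV[R]_n.+1) : y *m U = y - (k * mxdot y v) *: v.
  rewrite mulmxBr mulmx1 -scalemxAr mulmxA; congr (_ - _).
  rewrite -scalerA; congr (_ *: _).
  by rewrite [y *m v^T]mx11_scalar -/(dotv y v) dotvE mul_scalar_mx.
have kvv : k * mxdot v v = 2 by rewrite divfK.
exists U.
  apply/row_matrixP => i; rewrite UT !rowE mulmxA !mulU mulmx1.
  set y := delta_mx 0 i.
  rewrite mxdotDl mxdotNl mxdotZl -addrA -opprD -scalerDl.
  suff -> : k * mxdot y v + k * (mxdot y v - k * mxdot y v * mxdot v v) = 0.
    by rewrite scale0r subr0.
  transitivity (2 * k * mxdot y v - k * mxdot v v * (k * mxdot y v)); first by ring.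
  by rewrite kvv; ring.
rewrite -/e mulU ev (_ : k * _ = -1); first by rewrite scaleN1r opprK addrC subrK.
have -> : mxdot x e - 1 = - (mxdot v v / 2) by rewrite vv; field.
by rewrite mulrN mulrA kvv divff.
Qed.

(** Induction on the size: an orthogonal change of basis sends e_0 to a unit eigenvector, symmetry
    then clears the first row and column off the diagonal, and the remaining block is diagonalised
    by induction. *)
Lemma spectral_symmetric n (A : 'M[R]_n) : A^T = A ->
  exists2 U : 'M[R]_n, U *m U^T = 1%:M &
    exists l : 'rV[R]_n, A = U^T *m diag_mx l *m U.
Proof.
elim: n A => [|n IH] A Asym.
  exists 1%:M; first by rewrite trmx1 mulmx1.
  by exists 0; apply/matrixP => -[].
have [x [a [x1 xA]]] := symmetric_eigenvector Asym.
have [U UU Ux] := orthogonal_completion x1.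
have UtU : U^T *m U = 1%:M by exact: mulmx1C.
have [B defB] : exists B : 'M[R]_(1 + n), B = U *m A *m U^T by eexists.
have Bsym : B^T = B by rewrite defB !trmx_mul trmxK Asym mulmxA.
have B0 : delta_mx 0 0 *m B = a *: (delta_mx 0 0 : 'rV[R]_(1 + n)).
  rewrite defB !mulmxA Ux xA -scalemxAl; congr (_ *: _).
  by rewrite -Ux -mulmxA UU mulmx1.
have B0j j : B 0 j = a * (j == 0)%:R.
  by move/rowP : B0 => /(_ j); rewrite -rowE !mxE eqxx/=.
pose B2 : 'M[R]_n := drsubmx B.
have [|V VV [l B2E]] := IH B2; first by rewrite /B2 -[in RHS]Bsym trmx_drsub.
have l0 : lshift n (0 : 'I_1) = 0 :> 'I_(1 + n) by apply: val_inj.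
have ur0 : ursubmx B = 0.
  by apply/matrixP => i j; rewrite !mxE !ord1 l0 B0j mulr0.
have BE : B = block_mx a%:M 0 0 B2.
  rewrite -[LHS](@submxK _ 1 n 1 n) -/B2 ur0; congr block_mx.
    by apply/matrixP => i j; rewrite !mxE !ord1 l0 B0j mulr1.
  by rewrite -[LHS]trmxK trmx_dlsub Bsym ur0 trmx0.
pose W : 'M[R]_(1 + n) := block_mx 1%:M 0 0 V.
have WW : W *m W^T = 1%:M.
  rewrite /W tr_block_mx mulmx_block !trmx0 trmx1 !mulmx0 !mul0mx !addr0 !add0r.
  by rewrite mulmx1 VV -scalar_mx_block.
exists (W *m U).
  by rewrite trmx_mul mulmxA -(mulmxA W) UU mulmx1 WW.
exists (row_mx a%:M l).
have BD : B = W^T *m diag_mx (row_mx a%:M l) *m W.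
  rewrite BE B2E diag_mx_row /W tr_block_mx !mulmx_block.
  rewrite !trmx0 trmx1 ?(mulmx0, mul0mx, addr0, add0r, mulmx1, mul1mx).
  by congr block_mx; apply/matrixP => i j; rewrite !mxE !ord1.
transitivity (U^T *m (W^T *m diag_mx (row_mx a%:M l) *m W) *m U).
  by rewrite -BD defB !mulmxA UtU mul1mx -mulmxA UtU mulmx1.
by rewrite trmx_mul !mulmxA.
Qed.

End Spectral.

(** * Orthogonal diagonalisation and the Loewner order *)

Definition spec {R : realType} {n : nat} (U : 'M[R]_n) (l : 'rV[R]_n) : 'M[R]_n :=
  U^T *m diag_mx l *m U.

Section Loewner.
Context {R : realType} {n : nat}.
Implicit Types (U A B M : 'M[R]_n) (l k : 'rV[R]_n).

Lemma tr_spec U l : (spec U l)^T = spec U l.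
Proof. by rewrite /spec !trmx_mul trmxK tr_diag_mx mulmxA. Qed.

Lemma specB U l k : spec U l - spec U k = spec U (l - k).
Proof. by rewrite /spec -mulmxBl -mulmxBr -linearB. Qed.

(** By cyclicity of the trace only the diagonal of [M] in the basis [U] counts. This turns pairings
    with functions of the Hessian into sums over eigenvalues. *)
Lemma mxdot_spec U l M :
  mxdot (spec U l) M = \sum_i l 0 i * (U *m M *m U^T) i i.
Proof.
rewrite mxdotC /mxdot tr_spec /spec !mulmxA mxtrace_mulC !mulmxA mxtrace_mulC.
rewrite -mulmxA mul_diag_mx; apply: eq_bigr => i _.
by rewrite mxE mulmxA.
Qed.

Lemma conj_diagE U B i : (U *m B *m U^T) i i = mxdot (row i U *m B) (row i U).
Proof.
rewrite -[LHS](_ : (row i (U *m B *m U^T)) 0 i = _); last by rewrite mxE.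
rewrite !row_mul -dotvE /dotv !mxE; apply: eq_bigr => j _.
by rewrite !mxE.
Qed.

Lemma loewner_geP a A : A^T = A ->
  loewner_le a%:M A <-> forall x : 'rV[R]_n, a * mxdot x x <= mxdot (x *m A) x.
Proof.
move=> Asym; split => [[_ h] x|h].
  have := h x; rewrite dotvE mulmxBr mul_mx_scalar mxdotDl mxdotNl mxdotZl.
  by rewrite subr_ge0.
split; first by rewrite linearB/= Asym tr_scalar_mx.
move=> x; rewrite dotvE mulmxBr mul_mx_scalar mxdotDl mxdotNl mxdotZl.
by rewrite subr_ge0.
Qed.

Lemma loewner_leP a A : A^T = A ->
  loewner_le A a%:M <-> forall x : 'rV[R]_n, mxdot (x *m A) x <= a * mxdot x x.
Proof.
move=> Asym; split => [[_ h] x|h].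
  have := h x; rewrite dotvE mulmxBr mul_mx_scalar mxdotDl mxdotNl mxdotZl.
  by rewrite subr_ge0.
split; first by rewrite linearB/= Asym tr_scalar_mx.
move=> x; rewrite dotvE mulmxBr mul_mx_scalar mxdotDl mxdotNl mxdotZl.
by rewrite subr_ge0.
Qed.

Lemma sum_row_mxdot m (M : 'M[R]_(m, n)) A :
  mxdot (M *m A) M = \sum_i mxdot (row i M *m A) (row i M).
Proof.
rewrite mxdotE; apply: eq_bigr => i _; rewrite -row_mul mxdotE big_ord1.
by apply: eq_bigr => j _; rewrite !mxE.
Qed.

Lemma mxdot_quad_ge m (M : 'M[R]_(m, n)) a A : A^T = A -> loewner_le a%:M A ->
  a * mxdot M M <= mxdot (M *m A) M.
Proof.
move=> Asym /(loewner_geP _ Asym) h.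
have -> : mxdot M M = mxdot (M *m 1%:M) M by rewrite mulmx1.
rewrite !sum_row_mxdot mulr_sumr.
by apply: ler_sum => i _; rewrite mulmx1; exact: h.
Qed.

Lemma mxdot_quad_le m (M : 'M[R]_(m, n)) a A : A^T = A -> loewner_le A a%:M ->
  mxdot (M *m A) M <= a * mxdot M M.
Proof.
move=> Asym /(loewner_leP _ Asym) h.
have -> : mxdot M M = mxdot (M *m 1%:M) M by rewrite mulmx1.
rewrite !sum_row_mxdot mulr_sumr.
by apply: ler_sum => i _; rewrite mulmx1; exact: h.
Qed.

Section Orthogonal.
Variables (U : 'M[R]_n).
Hypothesis UU : U *m U^T = 1%:M.

Lemma orthogonal_tr : U^T *m U = 1%:M.
Proof. exact: mulmx1C. Qed.

Lemma specM l k : spec U l *m spec U k = spec U (\row_i (l 0 i * k 0 i)).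
Proof.
rewrite /spec !mulmxA -(mulmxA _ U) UU mulmx1 -(mulmxA U^T) mulmx_diag.
by congr (_ *m diag_mx _ *m _); apply/rowP => i; rewrite !mxE.
Qed.

Lemma spec_const a : spec U (const_mx a) = a%:M.
Proof. by rewrite /spec diag_const_mx mul_mx_scalar -scalemxAl orthogonal_tr scalemx1. Qed.

Lemma spec_conj l : U *m spec U l *m U^T = diag_mx l.
Proof. by rewrite /spec !mulmxA UU mul1mx -mulmxA UU mulmx1. Qed.

Lemma det_spec l : \det (spec U l) = \prod_i l 0 i.
Proof.
rewrite /spec !det_mulmx mulrC mulrA -det_mulmx UU det1 mul1r det_diag.
by [].
Qed.

Lemma invmx_spec l : (forall i, l 0 i != 0) ->
  invmx (spec U l) = spec U (\row_i (l 0 i)^-1).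
Proof.
move=> l0; have h : spec U l *m spec U (\row_i (l 0 i)^-1) = 1%:M.
  rewrite specM -(spec_const 1); congr spec; apply/rowP => i.
  by rewrite !mxE mulfV.
have [Su _] := mulmx1_unit h.
by rewrite -[RHS](mulKmx Su) h mulmx1.
Qed.

Lemma norm_row_orthogonal i : mxdot (row i U) (row i U) = 1.
Proof. by rewrite -[X in mxdot X _]mulmx1 -conj_diagE mulmx1 UU mxE eqxx. Qed.

Lemma quad_spec l (x : 'rV[R]_n) :
  mxdot (x *m spec U l) x = \sum_i l 0 i * (x *m U^T) 0 i ^+ 2.
Proof.
rewrite mxdot_mulr mxdot_spec; apply: eq_bigr => i _; congr (_ * _).
rewrite mulmxA -mulmxA mxE big_ord1 -[U *m _]trmxK trmx_mul trmxK.
by rewrite mxE -expr2.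
Qed.

(** The entry is the Rayleigh quotient of [B] at the unit vector [row i U]. [B] need not be diagonal
    in the basis [U], so arbitrary feasible matrices can be tested against spectral ones. *)
Lemma conj_diag_ge a B i : B^T = B -> loewner_le a%:M B -> a <= (U *m B *m U^T) i i.
Proof.
move=> Bsym /(loewner_geP _ Bsym)/(_ (row i U)).
by rewrite norm_row_orthogonal mulr1 conj_diagE.
Qed.

Lemma conj_diag_le a B i : B^T = B -> loewner_le B a%:M -> (U *m B *m U^T) i i <= a.
Proof.
move=> Bsym /(loewner_leP _ Bsym)/(_ (row i U)).
by rewrite norm_row_orthogonal mulr1 conj_diagE.
Qed.

Lemma sqr_norm_orthogonal (x : 'rV[R]_n) : \sum_i (x *m U^T) 0 i ^+ 2 = mxdot x x.
Proof.
rewrite -[X in mxdot X _]mulmx1 -(spec_const 1) quad_spec.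
by apply: eq_bigr => i _; rewrite [const_mx _ _ _]mxE mul1r.
Qed.

Lemma loewner_ge_spec a l : loewner_le a%:M (spec U l) <-> forall i, a <= l 0 i.
Proof.
split=> [h i|h].
  have := conj_diag_ge i (tr_spec U l) h.
  by rewrite spec_conj mxE eqxx mulr1n.
apply/(loewner_geP _ (tr_spec U l)) => x.
rewrite quad_spec -sqr_norm_orthogonal mulr_sumr; apply: ler_sum => i _.
by rewrite ler_wpM2r// sqr_ge0.
Qed.

Lemma loewner_le_spec a l : loewner_le (spec U l) a%:M <-> forall i, l 0 i <= a.
Proof.
split=> [h i|h].
  have := conj_diag_le i (tr_spec U l) h.
  by rewrite spec_conj mxE eqxx mulr1n.
apply/(loewner_leP _ (tr_spec U l)) => x.
rewrite quad_spec -sqr_norm_orthogonal mulr_sumr; apply: ler_sum => i _.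
by rewrite ler_wpM2r// sqr_ge0.
Qed.

End Orthogonal.
End Loewner.

(** * Square roots and log-determinants *)

Section SquareRoot.
Context {R : realType} {n : nat}.
Implicit Types (U V A B M : 'M[R]_n) (l k : 'rV[R]_n).

(** With M = A - B, equality of the squares reads M A + B M = 0. Pairing with M gives a nonnegative
    term plus one that is at least a |M|^2. *)
Lemma psd_sqrt_uniq A B a : psdmx A -> psdmx B -> 0 < a -> loewner_le a%:M B ->
  A *m A = B *m B -> A = B.
Proof.
move=> [Asym Apsd] [Bsym _] a0 Ba AB; apply/eqP; rewrite -subr_eq0 -mxdot_eq0.
set M := A - B.
have Msym : M^T = M by rewrite /M linearB/= Asym Bsym.
have h0 : M *m A + B *m M = 0.
  by rewrite mulmxBl mulmxBr AB addrA subrK subrr.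
have h : mxdot (M *m A) M + mxdot (M *m B) M = 0.
  rewrite -(mxdot_tr (M *m B)) trmx_mul Msym Bsym -mxdotDl.
  by rewrite h0 mxdot0l.
have hA : 0 <= mxdot (M *m A) M.
  rewrite sum_row_mxdot; apply: sumr_ge0 => i _.
  by rewrite -dotvE; exact: Apsd.
have hB := mxdot_quad_ge M Bsym Ba.
rewrite eq_le mxdot_ge0 andbT -(pmulr_rle0 _ a0); lra.
Qed.

(** [sqrtmx] is a choice among positive semidefinite roots, so its value is found through
    uniqueness; the bound [a] makes the explicit root definite, as [psd_sqrt_uniq] asks. *)
Lemma sqrtmx_spec U l a : U *m U^T = 1%:M -> 0 < a -> (forall i, a <= l 0 i) ->
  sqrtmx (spec U l) = spec U (\row_i Num.sqrt (l 0 i)).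
Proof.
move=> UU a0 la; set S := RHS.
have l0 i : 0 <= l 0 i by rewrite (le_trans (ltW a0)).
have SS : S *m S = spec U l.
  by rewrite specM//; congr spec; apply/rowP => i; rewrite !mxE -expr2 sqr_sqrtr.
have Sa : loewner_le (Num.sqrt a)%:M S.
  by apply/loewner_ge_spec => // i; rewrite mxE ler_wsqrtr.
have S0 : psdmx S.
  split; first exact: tr_spec.
  move=> x; rewrite dotvE.
  have /(loewner_geP _ (tr_spec U _))/(_ x) := Sa.
  by apply: le_trans; rewrite mulr_ge0 ?sqrtr_ge0 ?mxdot_ge0.
rewrite /sqrtmx; case: xgetP => [B _ [B0 BB]|/(_ S)]; last by case.
apply: (psd_sqrt_uniq B0 S0 _ Sa); first by rewrite sqrtr_gt0.
by rewrite BB SS.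
Qed.

Lemma cov_set_spec (tau zeta : R) A : cov_set tau zeta A ->
  exists2 U, U *m U^T = 1%:M & exists2 l, A = spec U l &
    forall i, zeta^-1 <= l 0 i <= tau^-1.
Proof.
move=> [Asym h1 h2]; have [U UU [l AE]] := spectral_symmetric Asym.
exists U => //; exists l => // i.
move: h1 h2; rewrite AE => /(loewner_ge_spec UU)/(_ i)-> /(loewner_le_spec UU)/(_ i).
by [].
Qed.

Lemma spec_cov_set (tau zeta : R) U l : U *m U^T = 1%:M ->
  (forall i, zeta^-1 <= l 0 i <= tau^-1) -> cov_set tau zeta (spec U l).
Proof.
move=> UU h; split; first exact: tr_spec.
- by apply/loewner_ge_spec => // i; have /andP[] := h i.
- by apply/loewner_le_spec => // i; have /andP[] := h i.
Qed.

(* Klein's inequality: both sides are sums over [i], [j] against the doubly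
   stochastic matrix with entries [(U V^T)_ij ^ 2]. *)
Lemma ln_det_spec_le U V l k : U *m U^T = 1%:M -> V *m V^T = 1%:M ->
  (forall i, 0 < l 0 i) -> (forall i, 0 < k 0 i) ->
  \sum_i ln (k 0 i) <= \sum_i ln (l 0 i) +
    mxdot (spec U (\row_i (l 0 i)^-1)) (spec V k - spec U l).
Proof.
move=> UU VV l0 k0; have [W WE] : exists W, W = U *m V^T by eexists.
have WW : W *m W^T = 1%:M.
  by rewrite WE trmx_mul trmxK mulmxA -(mulmxA U) (orthogonal_tr VV) mulmx1.
have r1 i : \sum_j W i j ^+ 2 = 1.
  transitivity ((W *m W^T) i i); last by rewrite WW mxE eqxx.
  by rewrite mxE; apply: eq_bigr => j _; rewrite mxE expr2.
have c1 j : \sum_i W i j ^+ 2 = 1.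
  transitivity ((W^T *m W) j j); last by rewrite (orthogonal_tr WW) mxE eqxx.
  by rewrite mxE; apply: eq_bigr => i _; rewrite mxE expr2.
have -> : mxdot (spec U (\row_i (l 0 i)^-1)) (spec V k - spec U l) =
    \sum_i ((\sum_j W i j ^+ 2 * k 0 j) / l 0 i - 1).
  rewrite mxdot_spec; apply: eq_bigr => i _.
  have -> : U *m (spec V k - spec U l) *m U^T = W *m diag_mx k *m W^T - diag_mx l.
    rewrite mulmxBr mulmxBl spec_conj// WE trmx_mul trmxK /spec !mulmxA.
    by rewrite -(mulmxA _ V).
  rewrite !mxE eqxx mulr1n mulrC mulrBl divff ?gt_eqF//; congr (_ / _ - _).
  by apply: eq_bigr => j _; rewrite mul_mx_diag !mxE expr2 mulrAC.
have -> : \sum_i ln (k 0 i) = \sum_i \sum_j W i j ^+ 2 * ln (k 0 j).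
  by rewrite exchange_big/=; apply: eq_bigr => j _; rewrite -mulr_suml c1 mul1r.
rewrite -big_split/=; apply: ler_sum => i _.
have -> : ln (l 0 i) + ((\sum_j W i j ^+ 2 * k 0 j) / l 0 i - 1) =
    \sum_j W i j ^+ 2 * (ln (l 0 i) + (k 0 j / l 0 i - 1)).
  under [RHS]eq_bigr do rewrite mulrDr mulrBr mulr1 mulrA.
  by rewrite big_split/= sumrB -mulr_suml -mulr_suml r1 mul1r.
apply: ler_sum => j _; rewrite ler_wpM2l ?sqr_ge0//.
have kl0 : 0 < k 0 j / l 0 i by rewrite divr_gt0.
have -> : ln (k 0 j) = ln (l 0 i) + ln (k 0 j / l 0 i).
  by rewrite ln_div ?posrE//; lra.
rewrite lerD2l; have := @le_ln1Dx R (k 0 j / l 0 i - 1); rewrite (addrC 1) subrK; apply.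
by rewrite -subr_gt0 opprK subrK.
Qed.

(** A^2 - B^2 = A (A - B) + (A - B) B, and both factors have operator norm at most c. It brings a
    bound on roots back to covariances, with c = 1 / sqrt tau. *)
Lemma frob_sqrB_le A B c : A^T = A -> B^T = B ->
  loewner_le (A *m A) (c ^+ 2)%:M -> loewner_le (B *m B) (c ^+ 2)%:M -> 0 <= c ->
  frob (A *m A - B *m B) <= 2 * c * frob (A - B).
Proof.
have mul_le M B' : B'^T = B' -> loewner_le (B' *m B') (c ^+ 2)%:M -> 0 <= c ->
    frob (M *m B') <= c * frob M.
  move=> Bs BB c0; rewrite -ler_sqr ?nnegrE ?mulr_ge0 ?frob_ge0// exprMn !frob_sqr.
  rewrite mxdot_mull mxdotC -mulmxA Bs.
  by apply: mxdot_quad_le => //; rewrite trmx_mul Bs.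
move=> As Bs AA BB c0.
have -> : A *m A - B *m B = A *m (A - B) + (A - B) *m B.
  by rewrite mulmxBr mulmxBl addrA subrK.
apply: le_trans (frobD _ _) _; rewrite mulr2n mulrDl mul1r mulrDl; apply: lerD.
  by rewrite -frob_tr trmx_mul As -(frob_tr (A - B)) mul_le.
exact: mul_le.
Qed.

(** The sum of squares of nonnegative eigenvalues is at most the square of their sum. Needed because
    the linear growth of the model is first obtained as a trace. *)
Lemma frob_le_mxtrace_spec U l : U *m U^T = 1%:M -> (forall i, 0 <= l 0 i) ->
  frob (spec U l) <= \sum_i l 0 i.
Proof.
move=> UU l0.
rewrite -ler_sqr ?nnegrE ?frob_ge0 ?sumr_ge0// frob_sqr.
rewrite mxdot_spec expr2 mulr_suml; apply: ler_sum => i _.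
rewrite ler_wpM2l// spec_conj// mxE eqxx mulr1n (bigD1 i)//= lerDl sumr_ge0//.
Qed.

End SquareRoot.

(** * Projection onto the covariance set *)

Definition clip {R : realType} (lo hi x : R) : R := Num.max lo (Num.min hi x).

Section Projection.
Context {R : realType} {n : nat} {tau zeta : R}.
Hypotheses (tau0 : 0 < tau) (tau_zeta : tau <= zeta).
Implicit Types (U A M X : 'M[R]_n) (l a : 'rV[R]_n).

Let zeta0 : 0 < zeta. Proof. exact: lt_le_trans tau_zeta. Qed.

Let lo_hi : zeta^-1 <= tau^-1. Proof. by rewrite lef_pV2. Qed.

Lemma clip_itv x : zeta^-1 <= clip zeta^-1 tau^-1 x <= tau^-1.
Proof. by rewrite /clip le_max lexx ge_max lo_hi ge_min lexx. Qed.

Lemma clip_obtuse x y : zeta^-1 <= y <= tau^-1 ->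
  0 <= (x - clip zeta^-1 tau^-1 x) * (clip zeta^-1 tau^-1 x - y).
Proof.
move=> /andP[loy yhi]; rewrite /clip.
have [xhi|hix] := leP x tau^-1.
  have [lox|xlo] := leP zeta^-1 x; first by rewrite subrr mul0r.
  by apply: mulr_le0; lra.
by rewrite (max_idPr lo_hi); apply: mulr_ge0; lra.
Qed.

(** In the eigenbasis of the projected matrix this is a sum of scalar obtuse-angle inequalities: the
    diagonal entries of [X] there are Rayleigh quotients, hence lie in the interval onto which the
    eigenvalues are clipped. *)
Lemma proj_obtuse_spec U a X : U *m U^T = 1%:M -> cov_set tau zeta X ->
  0 <= mxdot (spec U a - spec U (\row_i clip zeta^-1 tau^-1 (a 0 i)))
             (spec U (\row_i clip zeta^-1 tau^-1 (a 0 i)) - X).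
Proof.
move=> UU [Xs Xlo Xhi]; rewrite specB mxdot_spec; apply: sumr_ge0 => i _.
rewrite mulmxBr mulmxBl spec_conj//.
have := @clip_obtuse (a 0 i) ((U *m X *m U^T) i i).
rewrite conj_diag_ge ?conj_diag_le// => /(_ isT).
by move: (U *m X *m U^T) => Y; rewrite !mxE eqxx mulr1n.
Qed.

Lemma frob_sqr_obtuse A P X : 0 <= mxdot (A - P) (P - X) ->
  frob (A - P) ^+ 2 + frob (P - X) ^+ 2 <= frob (A - X) ^+ 2.
Proof.
have -> : A - X = (A - P) + (P - X) by rewrite addrA subrK.
rewrite !frob_sqr; move: (A - P) (P - X) => B C.
by rewrite mxdotDl !mxdotDr (mxdotC C B); lra.
Qed.

(** The obtuse angle at P gives |A - P|^2 + |P - X|^2 <= |A - X|^2 for feasible X, so P is a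
    minimiser and the only one; hence the choice made by [proj_cov] is P. *)
Lemma proj_cov_spec U a : U *m U^T = 1%:M ->
  proj_cov tau zeta (spec U a) = spec U (\row_i clip zeta^-1 tau^-1 (a 0 i)).
Proof.
move=> UU; set P := RHS; have Pcov : cov_set tau zeta P.
  by apply: spec_cov_set => // i; rewrite mxE clip_itv.
have obt X : cov_set tau zeta X -> 0 <= mxdot (spec U a - P) (P - X).
  exact: proj_obtuse_spec.
rewrite /proj_cov; case: xgetP => [X _ [Xcov Xmin]|/(_ P)].
  have /(_ P Pcov) := Xmin; have := frob_sqr_obtuse (obt X Xcov).
  rewrite -(@ler_sqr _ (frob _) (frob _)) ?nnegrE ?frob_ge0// => h1 h2.
  have : frob (P - X) ^+ 2 <= 0 by lra.
  rewrite le_eqVlt ltNge sqr_ge0 orbF sqrf_eq0 frob_eq0 subr_eq0.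
  by move/eqP.
case; split => // Y /obt/frob_sqr_obtuse h.
rewrite -ler_sqr ?nnegrE ?frob_ge0//; apply: le_trans h.
by rewrite lerDl sqr_ge0.
Qed.

Lemma proj_covP A : A^T = A -> cov_set tau zeta (proj_cov tau zeta A) /\
  forall X, cov_set tau zeta X ->
    0 <= mxdot (A - proj_cov tau zeta A) (proj_cov tau zeta A - X).
Proof.
move=> /spectral_symmetric[U UU [a ->]]; rewrite proj_cov_spec//; split.
  by apply: spec_cov_set => // i; rewrite mxE clip_itv.
by move=> X Xcov; exact: proj_obtuse_spec.
Qed.

(** Test each variational inequality at the other projection and add: |P - Q|^2 is at most the inner
    product of A - B and P - Q. Cauchy-Schwarz concludes. *)
Lemma proj_cov_nonexpansive A B : A^T = A -> B^T = B ->
  frob (proj_cov tau zeta A - proj_cov tau zeta B) <= frob (A - B).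
Proof.
move=> /proj_covP[Pc PX] /proj_covP[Qc QX].
have := PX _ Qc; have := QX _ Pc.
set P := proj_cov _ _ A; set Q := proj_cov _ _ B => h1 h2.
have [->|PQ0] := eqVneq (P - Q) 0; first by rewrite frob0 frob_ge0.
have PQgt0 : 0 < frob (P - Q) by rewrite lt_neqAle eq_sym frob_eq0 PQ0 frob_ge0.
rewrite -(ler_pM2r PQgt0) -expr2; apply: le_trans (mxdot_ler _ _).
have -> : A - B = (A - P) - (B - Q) + (P - Q).
  by apply/matrixP => i j; rewrite !mxE; ring.
rewrite frob_sqr [leRHS]mxdotDl lerDr mxdotDl mxdotNl.
by move: h1; rewrite -(opprB P Q) mxdotNr => h1; rewrite addr_ge0.
Qed.

End Projection.

(** * Growth of the quadratic model around the projection *)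

Section EnergyGap.
Context {R : realType} {n : nat} {tau zeta : R}.
Hypotheses (tau0 : 0 < tau) (tau_zeta : tau <= zeta).
Implicit Types (U V H S M X : 'M[R]_n) (l k h : 'rV[R]_n).

Let zeta0 : 0 < zeta. Proof. exact: lt_le_trans tau_zeta. Qed.

Lemma ln_prod (I : finType) (F : I -> R) : (forall i, 0 < F i) ->
  ln (\prod_i F i) = \sum_i ln (F i).
Proof.
move=> F0; suff [] : 0 < \prod_i F i /\ ln (\prod_i F i) = \sum_i ln (F i) by [].
elim/big_rec2 : _ => [|i x y _ [y0 <-]]; first by rewrite ltr01 ln1.
by rewrite mulr_gt0// lnM ?posrE.
Qed.

Lemma sqrtmx_cov_spec S : cov_set tau zeta S ->
  exists2 V, V *m V^T = 1%:M & exists k,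
    [/\ sqrtmx S = spec V k, S = spec V k *m spec V k,
        forall i, Num.sqrt zeta^-1 <= k 0 i <= Num.sqrt tau^-1
      & ln (\det S) = 2 * \sum_i ln (k 0 i)].
Proof.
move=> /cov_set_spec[V VV [l -> lb]]; exists V => //.
have b0 : 0 < zeta^-1 by rewrite invr_gt0.
have lz i : zeta^-1 <= l 0 i by have /andP[] := lb i.
have l0 i : 0 < l 0 i by rewrite (lt_le_trans b0).
exists (\row_i Num.sqrt (l 0 i)); split.
- exact: sqrtmx_spec VV b0 lz.
- rewrite specM//; congr spec; apply/rowP => i.
  by rewrite !mxE -expr2 sqr_sqrtr// ltW.
- by move=> i; rewrite mxE; have /andP[? ?] := lb i; rewrite !ler_wsqrtr.
- rewrite det_spec// ln_prod// mulr_sumr; apply: eq_bigr => i _.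
  by rewrite mxE -{1}(sqr_sqrtr (ltW (l0 i))) lnXn ?sqrtr_gt0// mulr_natl.
Qed.

(** First-order optimality for one eigenvalue: h p - 1/p is the derivative at p of h p^2 / 2 - ln p.
    Multiplying by positive factors turns it into [clip_obtuse] for the squares. *)
Lemma sqrt_clip_slope (h y p : R) : 0 < h ->
  p = Num.sqrt (clip zeta^-1 tau^-1 h^-1) ->
  Num.sqrt zeta^-1 <= y <= Num.sqrt tau^-1 -> 0 <= (h * p - p^-1) * (y - p).
Proof.
move=> h0 pE0 /andP[ylo yhi].
have /andP[qlo qhi] := clip_itv tau0 tau_zeta h^-1.
have zi0 : 0 < zeta^-1 by rewrite invr_gt0.
have p0 : 0 < p by rewrite pE0 sqrtr_gt0 (lt_le_trans zi0).
have pE : p ^+ 2 = clip zeta^-1 tau^-1 h^-1 by rewrite pE0 sqr_sqrtr// (le_trans (ltW zi0)).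
have y0 : 0 < y by rewrite (lt_le_trans _ ylo)// sqrtr_gt0.
have : 0 <= (h^-1 - p ^+ 2) * (p ^+ 2 - y ^+ 2).
  rewrite pE clip_obtuse//.
  have ti0 : 0 <= tau^-1 by rewrite invr_ge0 ltW.
  apply/andP; split.
    by rewrite -(sqr_sqrtr (ltW zi0)) ler_pXn2r ?nnegrE ?sqrtr_ge0 ?(ltW y0).
  by rewrite -(sqr_sqrtr ti0) ler_pXn2r ?nnegrE ?sqrtr_ge0 ?(ltW y0).
have -> : (h * p - p^-1) * (y - p) =
    (h / (p * (p + y))) * ((h^-1 - p ^+ 2) * (p ^+ 2 - y ^+ 2)).
  by field; rewrite !gt_eqF// addr_gt0.
by move=> H; rewrite mulr_ge0// divr_ge0 ?ltW// mulr_gt0// addr_gt0.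
Qed.

(** Expansion around the root of P: the second-order term of the quadratic form is at least sigma
    |M|^2, and ln det lies below its tangent by Klein's inequality. What remains is the first-order
    term, bounded in [lin] by optimality of P. *)
Lemma sqrtmx_energy_gap H S P (sigma : R) :
  H^T = H -> 0 < sigma -> loewner_le sigma%:M H -> cov_set tau zeta S ->
  P = proj_cov tau zeta (invmx H) ->
  (mxdot (sqrtmx P *m H) (sqrtmx P) - ln (\det P)) / 2 +
    sigma / 2 * frob (sqrtmx S - sqrtmx P) ^+ 2 +
    Num.sqrt zeta^-1 * Num.max 0 (sigma - zeta) * frob (sqrtmx S - sqrtmx P) <=
  (mxdot (sqrtmx S *m H) (sqrtmx S) - ln (\det S)) / 2.
Proof.
move=> Hs s0 Hsigma Scov PE0.
have [U UU [h HE]] := spectral_symmetric Hs; rewrite -/(spec U h) in HE.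
have sh : forall i, sigma <= h 0 i by apply/(loewner_ge_spec UU); rewrite -HE.
have [M defM] : exists M, M = sqrtmx S - sqrtmx P by eexists.
rewrite -defM.
have h0 i : 0 < h 0 i by exact: lt_le_trans (sh i).
have zi0 : 0 < zeta^-1 by rewrite invr_gt0.
pose q := \row_i clip zeta^-1 tau^-1 (h 0 i)^-1.
have qi i : zeta^-1 <= q 0 i <= tau^-1 by rewrite mxE clip_itv.
have qlo i : zeta^-1 <= q 0 i by have /andP[] := qi i.
have q0 i : 0 < q 0 i by rewrite (lt_le_trans zi0).
have PE : P = spec U q.
  rewrite PE0 HE invmx_spec ?proj_cov_spec// => [|i]; last by rewrite gt_eqF.
  by congr spec; apply/rowP => i; rewrite !mxE.
pose p := \row_i Num.sqrt (q 0 i).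
have sPE : sqrtmx P = spec U p by rewrite PE; exact: sqrtmx_spec UU zi0 qlo.
have p0 i : 0 < p 0 i by rewrite mxE sqrtr_gt0.
have lnP : ln (\det P) = 2 * \sum_i ln (p 0 i).
  rewrite PE det_spec// ln_prod// mulr_sumr; apply: eq_bigr => i _.
  by rewrite [p 0 i]mxE -{1}(sqr_sqrtr (ltW (q0 i))) lnXn ?sqrtr_gt0// mulr_natl.
have [V VV [k [sSE SE kb lnS]]] := sqrtmx_cov_spec Scov.
have k0 i : 0 < k 0 i.
  by have /andP[+ _] := kb i; apply: lt_le_trans; rewrite sqrtr_gt0.
have ME : M = spec V k - spec U p by rewrite defM sSE sPE.
have klein := ln_det_spec_le UU VV p0 k0; rewrite -ME in klein.
have quadM := mxdot_quad_ge M Hs Hsigma.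
have expand : mxdot (sqrtmx S *m H) (sqrtmx S) = mxdot (sqrtmx P *m H) (sqrtmx P)
    + 2 * mxdot (sqrtmx P *m H) M + mxdot (M *m H) M.
  have -> : sqrtmx S = sqrtmx P + M by rewrite defM addrC subrK.
  have HM : mxdot (M *m H) (sqrtmx P) = mxdot (sqrtmx P *m H) M.
    by rewrite mxdot_mull Hs mxdotC.
  by rewrite mulmxDl !mxdotDl !mxdotDr HM; ring.
(* The gradient of the model at the root of P is diagonal in the eigenbasis of H, with entries h_i
   p_i - 1/p_i. *)
have lin : Num.sqrt zeta^-1 * Num.max 0 (sigma - zeta) * frob M <=
    mxdot (sqrtmx P *m H) M - mxdot (spec U (\row_i (p 0 i)^-1)) M.
  rewrite -mxdotNl -mxdotDl sPE HE specM// specB mxdot_spec.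
  have -> : U *m M *m U^T = U *m spec V k *m U^T - diag_mx p.
    by rewrite ME mulmxBr mulmxBl spec_conj.
  apply: (@le_trans _ _ (\sum_i (h 0 i * p 0 i - (p 0 i)^-1) *
                             ((U *m spec V k *m U^T) i i - p 0 i))); last first.
    rewrite le_eqVlt; apply/orP; left; apply/eqP; apply: eq_bigr => i _.
    move: (U *m _ *m _) => Y; rewrite !mxE eqxx mulr1n; congr (_ * _).
    by rewrite mulrC.
  have bV : loewner_le (Num.sqrt zeta^-1)%:M (spec V k).
    by apply/loewner_ge_spec => // i; have /andP[] := kb i.
  have Vc : loewner_le (spec V k) (Num.sqrt tau^-1)%:M.
    by apply/loewner_le_spec => // i; have /andP[] := kb i.
  have y_itv i := conj_diag_ge UU i (tr_spec V k) bV.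
  have [sz|zs] := leP sigma zeta.
    rewrite (max_idPl _) ?subr_le0// mulr0 mul0r; apply: sumr_ge0 => i _.
    apply: sqrt_clip_slope => //; first by rewrite !mxE.
    by rewrite y_itv (conj_diag_le UU _ (tr_spec V k) Vc).
  (* Here every eigenvalue of H^-1 is clipped from below, so the root of P is scalar. As zeta p^2 =
     1, each slope h p - 1/p = p (h - zeta) is at least p (sigma - zeta). The increments sum to the
     trace of M, which is positive semidefinite, so this trace dominates |M|. *)
  have pb i : p 0 i = Num.sqrt zeta^-1.
    rewrite !mxE; congr Num.sqrt; apply/max_idPl; rewrite ge_min; apply/orP; right.
    by rewrite lef_pV2 ?posrE// (le_trans (ltW zs) (sh i)).
  rewrite (max_idPr _) ?subr_ge0 ?(ltW zs)//.
  apply: (@le_trans _ _ (\sum_i Num.sqrt zeta^-1 * (sigma - zeta) *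
      ((U *m spec V k *m U^T) i i - Num.sqrt zeta^-1))).
    rewrite -mulr_sumr ler_wpM2l ?mulr_ge0 ?sqrtr_ge0 ?subr_ge0 ?(ltW zs)//.
    have Mk : M = spec V (\row_i (k 0 i - Num.sqrt zeta^-1)).
      rewrite ME; have -> : spec U p = spec V (const_mx (Num.sqrt zeta^-1)).
        rewrite spec_const// -(spec_const UU); congr spec.
        by apply/rowP => i; rewrite pb mxE.
      by rewrite specB; congr spec; apply/rowP => i; rewrite !mxE.
    rewrite sumrB -[X in X - _]/(\tr (U *m spec V k *m U^T)).
    rewrite mxtrace_mulC mulmxA orthogonal_tr// mul1mx /spec mxtrace_mulC mulmxA VV.
    rewrite mul1mx mxtrace_diag -sumrB Mk.
    apply: le_trans (frob_le_mxtrace_spec VV _) _ => [i|].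
      by rewrite mxE subr_ge0; have /andP[] := kb i.
    by apply: ler_sum => i _; rewrite mxE.
  apply: ler_sum => i _; rewrite pb.
  rewrite ler_wpM2r ?subr_ge0// mulrBr lerB//.
    by rewrite mulrC ler_wpM2r ?sqrtr_ge0.
  rewrite -[leLHS]mulr1 ler_pdivrMl ?sqrtr_gt0// mulrA -expr2.
  by rewrite (sqr_sqrtr (ltW zi0)) mulVf ?lexx ?gt_eqF.
rewrite expand lnS lnP; rewrite frob_sqr; lra.
Qed.

End EnergyGap.

(** * Taylor estimates *)

Section LineDerivative.
Context {R : realType}.

Lemma is_derive_line (V W : normedModType R) (G : V -> W) (a z : V) (t : R) :
  differentiable G (a + t *: z) ->
  is_derive t 1 (fun s : R => G (a + s *: z)) ('d G (a + t *: z) z).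
Proof.
move=> dG.
have E : (fun h : R => h^-1 *:
      (((fun s : R => G (a + s *: z)) \o shift t) (h *: 1) - G (a + t *: z))) =
    (fun h : R => h^-1 *: ((G \o shift (a + t *: z)) (h *: z) - G (a + t *: z))).
  apply/funext => h /=; congr (_ *: (G _ - _)).
  by rewrite [h *: 1]mulr1 scalerDl addrCA.
have dz := @diff_derivable _ _ _ _ _ z dG.
split.
  by rewrite /derivable E.
by rewrite /derive E -deriveE.
Qed.

Lemma is_derive_mxdot m (w : 'rV[R]_m) (g : R -> 'rV[R]_m) (t : R) dg :
  is_derive t 1 g dg -> is_derive t 1 (fun s => mxdot w (g s)) (mxdot w dg).
Proof.
move=> [gder <-].
have gj j : is_derive t 1 (fun s => g s 0 j) ('D_1 g t 0 j).
  have /derivable_mxP/(_ 0 j) gd := gder.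
  by split => //; rewrite derive_mx// mxE.
have -> : (fun s => mxdot w (g s)) = \sum_j (fun s => w 0 j * g s 0 j).
  by apply/funext => s; rewrite mxdotE big_ord1 fct_sumE.
rewrite mxdotE big_ord1; exact: is_derive_sum.
Qed.

Lemma is_derive_quadratic (c k t : R) :
  is_derive t 1 (fun s : R => c * s + k * s ^+ 2) (c + 2 * k * t).
Proof.
have h1 : is_derive t (1 : R) (c \*: id) (c *: 1) by exact: is_deriveZ.
have h2 : is_derive t (1 : R) (k \*: (id ^+ 2)) (k *: (2%N%:R * id t ^+ 1 *: 1)).
  exact: is_deriveZ.
have := is_deriveD h1 h2; move/is_derive_eq; apply.
by rewrite expr1 /= [_ *: 1]mulr1 [_ *: 1]mulr1 [_ *: _]mulrA (mulrC k).
Qed.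

Lemma mean_value01 (g dg : R -> R) : (forall t : R, is_derive t 1 g (dg t)) ->
  exists2 c, 0 <= c <= 1 & g 1 - g 0 = dg c.
Proof.
move=> gdg.
have cg : {within `[0, 1], continuous g}.
  apply: derivable_within_continuous => t _; exact: ex_derive.
have [c c01 gE] := MVT_segment ler01 (fun t _ => gdg t) cg.
exists c; first by move: c01; rewrite in_itv.
by rewrite gE subr0 mulr1.
Qed.

End LineDerivative.

(** * Consequences of the Lipschitz Hessian and of strong convexity *)

Section TaylorBounds.
Context {R : realType} {d : nat} {f : 'rV[R]_d -> R} {L sigma gamma : R}.
Hypotheses (sigma0 : 0 < sigma) (gamma0 : 0 < gamma).
Hypotheses (fdiff : twice_differentiable f) (fsmooth : smooth L f).
Hypotheses (fconvex : strongly_convex sigma f) (fhess : lipschitz_hessian gamma f).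
Implicit Types x y z a v w mu : 'rV[R]_d.

Let g := gradient f.

Lemma gradientP x v : 'd f x v = mxdot (g x) v.
Proof.
have fx := fdiff.1 x.
rewrite {1}(row_sum_delta v) linear_sum/= mxdotE big_ord1; apply: eq_bigr => j _.
by rewrite linearZ/= -deriveE// /g mxE mulrC.
Qed.

Lemma hessianP x v : 'd g x v = v *m hessian f x.
Proof. by rewrite -deriveE ?deriveEjacobian//; exact: fdiff.2. Qed.

Lemma is_derive_f_line a z (t : R) :
  is_derive t 1 (fun s : R => f (a + s *: z)) (mxdot (g (a + t *: z)) z).
Proof. by rewrite -gradientP; apply: is_derive_line; exact: fdiff.1. Qed.

Lemma is_derive_gradient_line a z (t : R) :
  is_derive t 1 (fun s : R => g (a + s *: z)) (z *m hessian f (a + t *: z)).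
Proof. by rewrite -hessianP; apply: is_derive_line; exact: fdiff.2. Qed.

(** The vector remainder w is paired with itself, giving a scalar function on the segment.
    Subtracting k s^2 makes its derivative nonpositive, which yields the constant gamma / 2 from the
    mean value theorem without integrating. *)
Lemma gradient_taylor mu z :
  frob (g (mu + z) - g mu - z *m hessian f mu) <= gamma / 2 * frob z ^+ 2.
Proof.
have scal (A B C D K T : R) : D - C <= 2 * K * T ->
  A + (- C - K) - B = D + (- C + 2 * - K * T) -> A - B - C <= K by lra.
set w := _ - _ - _.
have [->|w0] := eqVneq w 0.
  by rewrite frob0 mulr_ge0 ?sqr_ge0// divr_ge0// ltW.
have fw0 : 0 < frob w by rewrite lt_neqAle eq_sym frob_eq0 w0 frob_ge0.
pose c := mxdot w (z *m hessian f mu); pose k := gamma / 2 * frob z ^+ 2 * frob w.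
have dpsi (t : R) : is_derive t 1
    (fun s : R => mxdot w (g (mu + s *: z)) + (- c * s + - k * s ^+ 2))
    (mxdot w (z *m hessian f (mu + t *: z)) + (- c + 2 * (- k) * t)).
  exact: is_deriveD (is_derive_mxdot w (is_derive_gradient_line mu z t))
    (is_derive_quadratic (- c) (- k) t).
have [t /andP[t0 _] ] := mean_value01 dpsi.
rewrite scale1r scale0r addr0 expr0n/= expr1n !mulr1 !mulr0 !addr0.
have : mxdot w (z *m hessian f (mu + t *: z)) - c <= 2 * k * t.
  rewrite /c -mxdotNr -mxdotDr -mulmxBr.
  apply: le_trans (mxdot_ler _ _) _.
  apply: le_trans (ler_wpM2l (frob_ge0 _) (frobM _ _)) _.
  apply: le_trans (ler_wpM2l (frob_ge0 _) (ler_wpM2l (frob_ge0 _) (fhess _ _))) _.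
  rewrite addrAC subrr add0r frobZ ger0_norm// /k.
  by rewrite le_eqVlt; apply/orP; left; apply/eqP; field.
have ww : frob w ^+ 2 = mxdot w (g (mu + z)) - mxdot w (g mu) - c.
  by rewrite frob_sqr {2}/w !mxdotDr !mxdotNr.
by move=> h1 h2; rewrite -(ler_pM2r fw0) -expr2 ww -/k; exact: scal h1 h2.
Qed.

(** The mean value theorem along [b] turns the second difference into a difference of two gradients,
    each then linearised at [x]. *)
Lemma second_difference x a b :
  `|f (x + a + b) - f (x + a) - (f (x + b) - f x) - mxdot (a *m hessian f x) b|
    <= gamma * (frob a + frob b) ^+ 3.
Proof.
have dpsi (t : R) : is_derive t 1
    (fun s : R => f (x + a + s *: b) - f (x + s *: b))
    (mxdot (g (x + a + t *: b)) b - mxdot (g (x + t *: b)) b).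
  exact: is_deriveB (is_derive_f_line (x + a) b t) (is_derive_f_line x b t).
have [t /andP[t0 t1]] := mean_value01 dpsi.
rewrite !scale1r !scale0r !addr0 => E.
have -> : f (x + a + b) - f (x + a) - (f (x + b) - f x) =
    mxdot (g (x + a + t *: b)) b - mxdot (g (x + t *: b)) b.
  by rewrite -E; ring.
pose r z := g (x + z) - g x - z *m hessian f x.
have -> : mxdot (g (x + a + t *: b)) b - mxdot (g (x + t *: b)) b -
    mxdot (a *m hessian f x) b = mxdot (r (a + t *: b) - r (t *: b)) b.
  rewrite -!mxdotNl -!mxdotDl; congr mxdot.
  rewrite /r mulmxDl addrA; set H := hessian f x; move: (g _) (g _) (g x) (a *m H) => u v p q.
  by apply/matrixP => i j; rewrite !mxE; ring.
apply: le_trans (mxdot_le _ _) _.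
have tb : frob (t *: b) <= frob b by rewrite frobZ ger0_norm// ler_piMl ?frob_ge0.
have atb : frob (a + t *: b) <= frob a + frob b.
  by apply: le_trans (frobD _ _) _; rewrite lerD2l.
have sq (u k : R) : 0 <= u -> u <= k -> u ^+ 2 <= k ^+ 2.
  by move=> u0 uk; rewrite ler_pXn2r ?nnegrE// (le_trans u0).
have h1 := sq _ _ (frob_ge0 _) atb.
have h2 : frob (t *: b) ^+ 2 <= (frob a + frob b) ^+ 2.
  by apply: sq; [exact: frob_ge0|rewrite (le_trans tb)// lerDr frob_ge0].
have -> : gamma * (frob a + frob b) ^+ 3 =
  (gamma * (frob a + frob b) ^+ 2) * (frob a + frob b) by ring.
apply: ler_pM; rewrite ?frob_ge0 ?lerDr ?frob_ge0//.
apply: le_trans (frobD _ _) _; rewrite frobN.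
have -> : gamma * (frob a + frob b) ^+ 2 =
  gamma / 2 * (frob a + frob b) ^+ 2 + gamma / 2 * (frob a + frob b) ^+ 2 by field.
have k0 : 0 <= gamma / 2 by rewrite divr_ge0// ltW.
apply: lerD; apply: le_trans (gradient_taylor _ _) _; exact: ler_wpM2l.
Qed.

(** The second difference is symmetric in its two directions. At scale t it equals the bilinear
    form, of order t^2, up to an error of order t^3; t tending to 0 transfers the symmetry. *)
Lemma hessian_sym x : (hessian f x)^T = hessian f x.
Proof.
pose H := hessian f x.
have half a b : mxdot (a *m H) b - mxdot (b *m H) a <= 0.
  apply: (@le0_linear_bound _ _ (2 * gamma * (frob a + frob b) ^+ 3)) => t /andP[t0 _].
  have := second_difference x (t *: a) (t *: b).
  have := second_difference x (t *: b) (t *: a).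
  rewrite (addrAC x) -!scalemxAl !mxdotZl !mxdotZr !frobZ !(ger0_norm (ltW t0)) -/H.
  rewrite (addrC (t * frob b)) -mulrDr exprMn.
  set F1 := f _ ; set F2 := f _; set F3 := f _; set F4 := f _.
  rewrite !ler_norml => /andP[h1 h2] /andP[h3 h4].
  have tt : 0 < t * t by rewrite mulr_gt0.
  rewrite -(ler_pM2l tt).
  have -> : t * t * (t * (2 * gamma * (frob a + frob b) ^+ 3)) =
    2 * (gamma * (t ^+ 3 * (frob a + frob b) ^+ 3)) by ring.
  by rewrite mulrBr -!mulrA; lra.
have eqH a b : mxdot (a *m H) b = mxdot (b *m H) a.
  by apply/eqP; rewrite eq_le -subr_le0 half -subr_le0 half.
apply/row_matrixP => i; apply/eqP; rewrite !rowE -/H -subr_eq0 -mulmxBr -mxdot_eq0.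
rewrite {1}mulmxBr mxdotDl mxdotNl [X in _ - X]eqH.
by rewrite [X in _ - X]mxdot_mull mxdotC subrr.
Qed.

Lemma gradient_monotone x y : sigma * frob (x - y) ^+ 2 <= mxdot (g x - g y) (x - y).
Proof.
have scal (A B C D E S : R) : A + S / 2 * C <= B - D -> - E + S / 2 * C <= D - B ->
  S * C <= E - A by lra.
have := fconvex y x; have := fconvex x y; rewrite !dotvE (frobBC y x) -/g.
by rewrite -(opprB x y) mxdotNr mxdotDl mxdotNl; exact: scal.
Qed.

(** Strong monotonicity of the gradient between x and x + t v, divided by t^2: the Taylor remainder
    of the gradient contributes only order t. *)
Lemma hessian_ge x : loewner_le sigma%:M (hessian f x).
Proof.
apply/loewner_geP; first exact: hessian_sym.
move=> v; rewrite -subr_le0.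
apply: (@le0_linear_bound _ _ (gamma / 2 * frob v ^+ 3)) => t /andP[t0 _].
have scal (F X V W p : R) : F * V <= gamma / 2 * (t * V) ^+ 2 * V -> X <= F * V ->
    sigma * (t ^+ 2 * p) <= t * X + t * (t * W) ->
    sigma * p - W <= t * (gamma / 2 * V ^+ 3).
  move=> h1 h2; have h : X <= t ^+ 2 * (gamma / 2 * V ^+ 3).
    by apply: le_trans h2 (le_trans h1 _); rewrite le_eqVlt; apply/orP; left; apply/eqP; ring.
  move=> h3; have tt : 0 < t ^+ 2 by rewrite exprn_gt0.
  rewrite -(ler_pM2l tt); have := ler_wpM2l (ltW t0) h.
  by move: (gamma / 2 * V ^+ 3) h3 => K; lra.
have := gradient_monotone (x + t *: v) x; have := gradient_taylor x (t *: v).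
rewrite (_ : x + t *: v - x = t *: v) -?scalemxAl; last by rewrite addrAC subrr add0r.
set r := _ - _ - _ => rle.
have -> : g (x + t *: v) - g x = r + t *: (v *m hessian f x) by rewrite subrK.
rewrite mxdotDl !mxdotZl !mxdotZr !frobZ (ger0_norm (ltW t0)) exprMn frob_sqr.
have := mxdot_ler r v; have := ler_wpM2r (frob_ge0 v) rle.
rewrite frobZ (ger0_norm (ltW t0)); exact: scal.
Qed.

(** Along the segment from y to x, the mean value theorem applied to f minus its quadratic model
    leaves the gradient remainder at one point z paired with x - y. By convexity |z|^2 <= K, so the
    error is linear in |x - y|; this is the source of the Lipschitz remainder. *)
Lemma increment_lower_bound mu x y K :
  frob x ^+ 2 <= K -> frob y ^+ 2 <= K ->
  mxdot (g mu) (x - y)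
    + (mxdot (x *m hessian f mu) x - mxdot (y *m hessian f mu) y) / 2
    - gamma / 2 * K * frob (x - y) <= f (mu + x) - f (mu + y).
Proof.
move=> xK yK; set H := hessian f mu.
have [v xE] : exists v, x = y + v by exists (x - y); rewrite addrC subrK.
have Hs : H^T = H by exact: hessian_sym.
have -> : x - y = v by rewrite xE addrAC subrr add0r.
pose c := - mxdot (g mu) v - mxdot (y *m H) v.
have dpsi (t : R) : is_derive t 1
    (fun s : R => f (mu + y + s *: v) + (c * s + (- mxdot (v *m H) v / 2) * s ^+ 2))
    (mxdot (g (mu + y + t *: v)) v + (c + 2 * (- mxdot (v *m H) v / 2) * t)).
  exact: is_deriveD (is_derive_f_line (mu + y) v t)
    (is_derive_quadratic c (- mxdot (v *m H) v / 2) t).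
have [t /andP[t0 t1]] := mean_value01 dpsi.
rewrite scale1r scale0r addr0 expr0n/= expr1n !mulr1 !mulr0 !addr0 -!addrA -xE => E.
pose z := y + t *: v.
have zK : frob z ^+ 2 <= K.
  have : frob z ^+ 2 <= (1 - t) * frob y ^+ 2 + t * frob x ^+ 2.
    rewrite !frob_sqr /z xE !mxdotDl !mxdotDr !mxdotZl !mxdotZr (mxdotC v y).
    have : 0 <= t * (1 - t) * mxdot v v by rewrite !mulr_ge0 ?subr_ge0 ?mxdot_ge0.
    by move: (mxdot v v) (mxdot y y) (mxdot y v) => A B C; lra.
  move=> h; apply: le_trans h _; have -> : K = (1 - t) * K + t * K by ring.
  by apply: lerD; rewrite ler_wpM2l// subr_ge0.
pose r := g (mu + z) - g mu - z *m H.
have rE : mxdot (g (mu + z)) v = mxdot r v + mxdot (g mu) v + mxdot (y *m H) v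
    + t * mxdot (v *m H) v.
  rewrite -mxdotZl scalemxAl -!mxdotDl; congr mxdot.
  by rewrite -addrA -mulmxDl -/z /r addrAC !subrK.
have rle : - (gamma / 2 * K * frob v) <= mxdot r v.
  rewrite lerNl; apply: le_trans (ler_norm _) _; rewrite normrN.
  apply: le_trans (mxdot_le _ _) _; apply: ler_wpM2r; first exact: frob_ge0.
  apply: le_trans (gradient_taylor _ _) _; apply: ler_wpM2l => //.
  by rewrite divr_ge0// ltW.
have vy : mxdot (v *m H) y = mxdot (y *m H) v by rewrite mxdot_mull Hs mxdotC.
rewrite [X in (X - _) / 2](_ : _ =
  mxdot (y *m H) y + 2 * mxdot (y *m H) v + mxdot (v *m H) v); last first.
  by rewrite xE mulmxDl !mxdotDl !mxdotDr vy; ring.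
by move: E; rewrite -addrA -/z rE /c; lra.
Qed.

(** The first-order inequality based at mu + x, followed by the Lipschitz bound on the gradient. The
    constant L, instead of L / 2, already leads to the term 2 d L alpha^2 / (sigma tau) of the
    theorem. *)
Lemma convex_upper_bound mu x : f (mu + x) <= f mu + mxdot (g mu) x + L * frob x ^+ 2.
Proof.
have scal (A B C D E N : R) : - C + sigma / 2 * N ^+ 2 <= A - B ->
    0 <= sigma / 2 * N ^+ 2 -> C = D + E -> E <= L * N ^+ 2 ->
    B <= A + D + L * N ^+ 2 by move=> *; lra.
have := fconvex mu (mu + x); rewrite dotvE -/g.
have -> : mu - (mu + x) = - x by rewrite opprD addrA subrr add0r.
rewrite mxdotNr frobN => h; apply: (scal _ _ _ _ (mxdot (g (mu + x) - g mu) x) _ h).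
- by rewrite mulr_ge0 ?sqr_ge0// divr_ge0// ltW.
- by rewrite -mxdotDl (addrC (g mu)) subrK.
- apply: le_trans (mxdot_ler _ _) _; rewrite expr2 mulrA ler_wpM2r ?frob_ge0//.
  by have := fsmooth (mu + x) mu; rewrite (_ : mu + x - mu = x)// addrAC subrr add0r.
Qed.

Lemma convex_lower_bound mu x :
  f mu + mxdot (g mu) x + sigma / 2 * frob x ^+ 2 <= f (mu + x).
Proof. have := fconvex (mu + x) mu; rewrite dotvE -/g.
rewrite (_ : mu + x - mu = x); last by rewrite addrAC subrr add0r.
by move: (f (mu + x)) (f mu) (mxdot _ _) (frob _ ^+ 2) => *; lra. Qed.

Lemma minimizer_gradient mu : minimizer setT f mu -> g mu = 0.
Proof.
move=> [_ fmin]; apply/eqP; rewrite -mxdot_eq0 eq_le mxdot_ge0 andbT.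
apply: (@le0_linear_bound _ _ (L * mxdot (g mu) (g mu))) => t /andP[t0 _].
have := convex_upper_bound mu (- t *: g mu); have := fmin (mu + - t *: g mu) I.
rewrite mxdotZr frobZ normrN (ger0_norm (ltW t0)) exprMn frob_sqr.
move=> h1 h2; rewrite -(ler_pM2l t0).
by move: (f _) (f _) (mxdot _ _) h1 h2 => A B C; lra.
Qed.

Lemma continuous_f : continuous f.
Proof. by move=> x; apply: differentiable_continuous; exact: fdiff.1. Qed.

End TaylorBounds.

(** * Moments of Gaussian laws *)

Section NormalMoments.
Context {R : realType}.

(** The Radon-Nikodym derivative of the normal law agrees almost everywhere with [normal_pdf], both
    having the same integral over every measurable set. *)
Lemma ge0_integral_normal_prob (m s : R) h :
  measurable_fun setT h -> (forall x, (0 <= h x)%E) ->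
  (\int[normal_prob m s]_x h x =
   \int[@lebesgue_measure R]_x (h x * (normal_pdf m s x)%:E))%E.
Proof.
move=> mh h0; have dom := @normal_prob_dominates R m s.
rewrite -(Radon_Nikodym_SigmaFinite.change_of_variables dom)//.
have mpdf : measurable_fun [set: R] (fun x : R => (normal_pdf m s x)%:E).
  by apply/measurable_EFinP; exact: measurable_normal_pdf.
have intRN := Radon_Nikodym_SigmaFinite.f_integrable dom.
apply: ae_eq_integral => //.
- by apply: emeasurable_funM => //; exact: measurable_int intRN.
- exact: emeasurable_funM.
- apply: ae_eqe_mul2l; apply: integral_ae_eq => // A _ mA.
  by rewrite -Radon_Nikodym_SigmaFinite.f_integral.
Qed.

Lemma normal_peakZ (s : R) : 0 < s -> normal_peak 1 = s * normal_peak s.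
Proof.
move=> s0; rewrite /normal_peak expr1n mul1r.
rewrite -[s ^+ 2 * pi *+ 2]mulr_natr -mulrA mulr_natr.
rewrite sqrtrM; last exact: sqr_ge0.
rewrite sqrtr_sqr gtr0_norm// invfM mulrA divff ?mul1r//.
by rewrite gt_eqF.
Qed.
Lemma normal_funX (s x : R) : 0 < s ->
  expR ((1 - (s ^+ 2)^-1) / 2 * x ^+ 2) * normal_fun 0 1 x = normal_fun 0 s x.
Proof.
move=> s0; rewrite /normal_fun -expRD; congr expR.
have sn0 : s != 0 by rewrite gt_eqF.
rewrite subr0 expr1n -[s ^+ 2 *+ 2]mulr_natr.
by field.
Qed.

(** The exponential factor turns the density of standard deviation 1 into s times the density of
    standard deviation s. *)
Lemma integral_normal_expR_sqr (s : R) : 0 < s ->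
  (\int[normal_prob (0 : R) 1]_x (expR ((1 - (s ^+ 2)^-1) / 2 * x ^+ 2))%:E = s%:E)%E.
Proof.
move=> s0; have sn0 : s != 0 by rewrite gt_eqF.
rewrite ge0_integral_normal_prob; last 2 first.
- apply/measurable_EFinP; apply: measurableT_comp => //.
  by apply: measurable_funM => //; exact: measurable_funX.
- by move=> x; rewrite lee_fin expR_ge0.
transitivity (\int[@lebesgue_measure R]_x (s%:E * (normal_pdf 0 s x)%:E))%E; last first.
  rewrite integralZl//; last exact: integrable_normal_pdf.
  by rewrite integral_normal_pdf mule1.
apply: eq_integral => x _; rewrite -!EFinM; congr EFin.
rewrite !normal_pdfE ?oner_eq0//= (normal_peakZ s0) -(normal_funX x s0).
by move: (expR _) (normal_peak s) (normal_fun 0 1 x) => A B C; ring.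
Qed.

Lemma expR_ge_quadratic (t : R) : 0 <= t -> 1 + t + t ^+ 2 / 2 <= expR t.
Proof.
move=> t0.
have dpsi (s : R) : is_derive s 1
    (fun s : R => expR (t * s) + (- t * s + - (t ^+ 2 / 2) * s ^+ 2))
    (expR (t * s) * t + (- t + 2 * (- (t ^+ 2 / 2)) * s)).
  have dl : is_derive s (1 : R) (fun s : R => t * s) t.
    have := @is_deriveZ R R R id t s 1 1 (is_derive_id _ _).
    by rewrite /GRing.scale/= mulr1.
  exact: is_deriveD (is_derive1_comp (is_derive_expR _) dl)
    (is_derive_quadratic (- t) (- (t ^+ 2 / 2)) s).
have [s /andP[s0 s1]] := mean_value01 dpsi.
rewrite !mulr0 expR0 !mulr1 expr0n expr1n/= mulr0 !addr0 => E.
have := ler_wpM2r t0 (expR_ge1Dx (t * s)).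
move: (expR _) (expR _) E => A B; lra.
Qed.

(* With [u = (1 - s ^-2) / 2] one has [E exp (u x^2) = s]. Bounding the exponential from
   below by its Taylor polynomial and letting [s] tend to 1 from both sides gives
   [E x^2 = 1], then [E x^4 <= 3]. *)
Lemma normal_moment24 : exists2 m4 : R, m4 <= 3 &
  (\int[normal_prob (0 : R) 1]_x (x ^+ 2)%:E = 1%:E)%E /\
  (\int[normal_prob (0 : R) 1]_x (x ^+ 4)%:E = m4%:E)%E.
Proof.
set g := normal_prob 0 1.
have mX k : measurable_fun setT (fun x : measurableTypeR R => (x ^+ k)%:E).
  by apply/measurable_EFinP; exact: measurable_funX.
pose e2 := (\int[g]_x (x ^+ 2)%:E)%E; pose e4 := (\int[g]_x (x ^+ 4)%:E)%E.
have X2_ge0 (x : R) : (0 <= (x ^+ 2)%:E)%E by rewrite lee_fin sqr_ge0.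
have X4_ge0 (x : R) : (0 <= (x ^+ 4)%:E)%E by rewrite lee_fin exprn_even_ge0.
have e2_ge0 : (0 <= e2)%E by apply: integral_ge0.
have e4_ge0 : (0 <= e4)%E by apply: integral_ge0.
(* For s > 1 one has u >= 0: the quadratic lower bound of the exponential has nonnegative terms, so
   it integrates in the extended reals before the moments are known to be finite. *)
have up (s u : R) : 1 < s -> u = (1 - (s ^+ 2)^-1) / 2 ->
    (1 + u%:E * e2 + (u ^+ 2 / 2)%:E * e4 <= s%:E)%E.
  move=> s1 uE.
  have u0 : 0 <= u.
    rewrite uE divr_ge0// subr_ge0 invf_le1 ?exprn_gt0 ?(lt_trans ltr01)//.
    by rewrite exprn_ege1// ltW.
  have u20 : 0 <= u ^+ 2 / 2 by rewrite divr_ge0// sqr_ge0.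
  have p2 (x : R) : (0 <= u%:E * (x ^+ 2)%:E)%E by rewrite mule_ge0.
  have p4 (x : R) : (0 <= (u ^+ 2 / 2)%:E * (x ^+ 4)%:E)%E by rewrite mule_ge0.
  have m2 : measurable_fun setT (fun x : measurableTypeR R => u%:E * (x ^+ 2)%:E)%E.
    exact: measurable_funeM.
  have m4 : measurable_fun setT
      (fun x : measurableTypeR R => (u ^+ 2 / 2)%:E * (x ^+ 4)%:E)%E.
    exact: measurable_funeM.
  have m12 : measurable_fun setT (fun x : measurableTypeR R => 1 + u%:E * (x ^+ 2)%:E)%E.
    exact: emeasurable_funD.
  have p12 (x : R) : (0 <= 1 + u%:E * (x ^+ 2)%:E)%E by rewrite adde_ge0.
  have -> : (1 + u%:E * e2 + (u ^+ 2 / 2)%:E * e4 =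
      \int[g]_x (1 + u%:E * (x ^+ 2)%:E + (u ^+ 2 / 2)%:E * (x ^+ 4)%:E))%E.
    rewrite ge0_integralD// ge0_integralD// integral_cst//= /g probability_setT mule1.
    by rewrite !ge0_integralZl_EFin.
  rewrite -(integral_normal_expR_sqr (lt_trans ltr01 s1)).
  apply: ge0_le_integral => //.
  - by move=> x _; rewrite adde_ge0.
  - exact: emeasurable_funD.
  - apply/measurable_EFinP; apply: measurableT_comp => //.
    by apply: measurable_funM => //; exact: measurable_funX.
  - move=> x _; rewrite -!EFinM -!EFinD lee_fin -uE.
    apply: le_trans (expR_ge_quadratic _); last by rewrite mulr_ge0// sqr_ge0.
    by rewrite lerD2l exprMn -exprM mulrAC.
have fin (e e' : \bar R) (a : R) : 0 < a -> (0 <= e')%E -> (0 <= e)%E ->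
    (1 + a%:E * e + e' <= 2%:E)%E -> e \is a fin_num.
  move=> a0 e'0; case: e => [//| |//] _.
  by rewrite gt0_muley ?lte_fin// addey// addye// gt_eqF// (lt_le_trans _ e'0)// ltNy0.
(* The value of u at s = 2; this single instance of [up] makes both moments finite. *)
have u38 : 3 / 8 = (1 - ((2 : R) ^+ 2)^-1) / 2 by field.
have h2 := up _ _ (ltr1n R 2) u38.
have fin2 : e2 \is a fin_num.
  have k0 : 0 < (3 / 8 : R) by rewrite divr_gt0.
  by apply: (fin _ _ _ k0 _ _ h2) => //; rewrite mule_ge0// lee_fin divr_ge0// sqr_ge0.
have fin4 : e4 \is a fin_num.
  rewrite addeAC in h2.
  have k0 : 0 < (3 / 8 : R) ^+ 2 / 2 by rewrite divr_gt0// exprn_gt0// divr_gt0.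
  by apply: (fin _ _ _ k0 _ _ h2) => //; rewrite mule_ge0// lee_fin divr_ge0.
pose m2 := fine e2; pose m4 := fine e4.
have e2E : e2 = m2%:E by rewrite fineK.
have e4E : e4 = m4%:E by rewrite fineK.
(* For s < 1 one has u <= 0; moving u x^2 to the other side of 1 + u x^2 <= exp (u x^2) keeps all
   integrands nonnegative. *)
have lo (s u : R) : 0 < s < 1 -> u = (1 - (s ^+ 2)^-1) / 2 -> 1 + u * m2 <= s.
  move=> /andP[s0 s1] uE.
  have u0 : 0 <= - u.
    rewrite oppr_ge0 uE pmulr_lle0// subr_le0 invf_ge1 ?exprn_gt0//.
    by rewrite exprn_ile1 ?ltW.
  suff : (1 <= s%:E + (- u)%:E * e2)%E by rewrite e2E -EFinM -EFinD lee_fin; lra.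
  have mexp : measurable_fun setT
      (fun x : measurableTypeR R => (expR (u * x ^+ 2))%:E).
    apply/measurable_EFinP; apply: measurableT_comp => //.
    by apply: measurable_funM => //; exact: measurable_funX.
  have mu2 : measurable_fun setT
      (fun x : measurableTypeR R => (- u)%:E * (x ^+ 2)%:E)%E.
    exact: measurable_funeM.
  have exp0 (x : R) : (0 <= (expR (u * x ^+ 2))%:E)%E by rewrite lee_fin expR_ge0.
  have sq0 (x : R) : (0 <= (- u)%:E * (x ^+ 2)%:E)%E by rewrite mule_ge0.
  have -> : (s%:E + (- u)%:E * e2 =
      \int[g]_x ((expR (u * x ^+ 2))%:E + (- u)%:E * (x ^+ 2)%:E))%E.
    rewrite ge0_integralD// ge0_integralZl_EFin// -/e2; congr (_ + _)%E.
    by rewrite uE integral_normal_expR_sqr.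
  have -> : 1%E = (\int[g]_x (cst 1%E x))%E.
    by rewrite integral_cst//= /g probability_setT mule1.
  apply: ge0_le_integral => //; first exact: emeasurable_funD.
  move=> x _; rewrite -EFinM -EFinD lee_fin mulNr.
  by have := expR_ge1Dx (u * x ^+ 2); lra.
have m20 : 0 <= m2 by rewrite fine_ge0.
have m40 : 0 <= m4 by rewrite fine_ge0.
have m2_le1 : m2 <= 1.
  rewrite -subr_le0; apply: (@le0_linear_bound _ _ 3) => t /andP[t0 t1].
  pose u := (1 - ((1 + t) ^+ 2)^-1) / 2.
  have w0 : 0 < 2 * (1 + t) ^+ 2 by rewrite mulr_gt0// exprn_gt0// addr_gt0.
  have uw : u * (2 * (1 + t) ^+ 2) = t * (2 + t).
    by rewrite /u; field; rewrite gt_eqF// addr_gt0.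
  have := up (1 + t) u _ erefl.
  rewrite ltrDl => /(_ t0); rewrite e2E e4E -!EFinM -!EFinD lee_fin => h.
  have hm : u * m2 <= t.
    have : 0 <= u ^+ 2 / 2 * m4 by rewrite mulr_ge0// divr_ge0// sqr_ge0.
    by move: h; move: (u * m2) (u ^+ 2 / 2 * m4) => A B; lra.
  have := ler_wpM2r (ltW w0) hm; rewrite mulrAC uw -!mulrA ler_pM2l// => hm2.
  have : 0 <= t * m2 by rewrite mulr_ge0// ltW.
  have : t ^+ 2 <= t by rewrite expr2 ler_piMl// ltW.
  by clear -hm2; lra.
have m2_ge1 : 1 <= m2.
  rewrite -subr_le0; apply: (@le0_linear_bound _ _ 2) => t /andP[t0 t1].
  have w0 : 0 < 1 + t by rewrite addr_gt0.
  have uE : - (t * (1 + t / 2)) = (1 - ((1 + t)^-1 ^+ 2)^-1) / 2.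
    by rewrite exprVn invrK; field.
  have := lo (1 + t)^-1 (- (t * (1 + t / 2))) _ uE.
  rewrite invr_gt0 w0 invf_lt1// ltrDl t0 => /(_ isT).
  rewrite -(ler_pM2r w0) mulVf ?gt_eqF// => h.
  have : t * 1 <= t * ((1 + t / 2) * (1 + t) * m2) by move: h; lra.
  rewrite ler_pM2l// => h'.
  have hh : 0 <= (1 + t / 2) * (1 + t) - 1.
    have : 0 <= t * t by rewrite mulr_ge0// ltW.
    by clear -t0; lra.
  have := ler_wpM2l hh m2_le1.
  have : t * t <= t by rewrite ler_piMl// ltW.
  by move: h'; lra.
have m21 : m2 = 1 by apply/eqP; rewrite eq_le m2_le1.
exists m4; last by rewrite -/e2 -/e4 e2E e4E m21.
(* As E x^2 = 1, the terms of order t cancel and (2 + t)^2 m4 <= 4 (3 + 2 t) (1 + t)^2 is left. The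
   constant is 17 = 8 + 7 + 2, the sum of the coefficients of t, t^2 and t^3 in (3 + 2 t) (1 +
   t)^2. *)
rewrite -subr_le0; apply: (@le0_linear_bound _ _ 17) => t /andP[t0 t1].
pose w := (1 + t) ^+ 2.
have w0 : 0 < w by rewrite exprn_gt0// addr_gt0.
have uE : t * (2 + t) / (2 * w) = (1 - ((1 + t) ^+ 2)^-1) / 2.
  by rewrite /w; field; rewrite gt_eqF// addr_gt0.
have := up (1 + t) (t * (2 + t) / (2 * w)) _ uE.
rewrite ltrDl => /(_ t0); rewrite e2E e4E m21 -!EFinM -!EFinD lee_fin mulr1 => h.
have k0 : 0 < 8 * w ^+ 2 / t ^+ 2.
  by apply: divr_gt0; [apply: mulr_gt0 => //|]; exact: exprn_gt0.
have : (2 + t) ^+ 2 * m4 <= 4 * (3 + 2 * t) * w.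
  have h3 : (t * (2 + t) / (2 * w)) ^+ 2 / 2 * m4 <= t - t * (2 + t) / (2 * w).
    by move: h; lra.
  have := ler_wpM2l (ltW k0) h3.
  have -> : 8 * w ^+ 2 / t ^+ 2 * ((t * (2 + t) / (2 * w)) ^+ 2 / 2 * m4) = (2 + t) ^+ 2 * m4.
    by field; rewrite !gt_eqF.
  have -> : 8 * w ^+ 2 / t ^+ 2 * (t - t * (2 + t) / (2 * w)) = 4 * (3 + 2 * t) * w.
    by rewrite /w; field; rewrite !gt_eqF// addr_gt0.
  by [].
have tt : t * t <= t by rewrite ler_piMl// ltW.
have ttt : t * (t * t) <= t * t by rewrite ler_pM2l.
have tm : 0 <= t * m4 by rewrite mulr_ge0// ltW.
have ttm : 0 <= t * t * m4 by rewrite !mulr_ge0// ltW.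
rewrite /w => H; clear -H tt ttt tm ttm; lra.
Qed.

(* From [1 + m E x <= E exp (m x) = exp (m^2 / 2)], letting [m] tend to 0 from both sides. *)
Lemma normal_moment1 : (\int[normal_prob (0 : R) 1]_x x%:E = 0)%E.
Proof.
set g := normal_prob 0 1; have [m4 _ [m2E _]] := normal_moment24.
have exp (m : R) : (\int[g]_x (expR (m * x))%:E = (expR (m ^+ 2 / 2))%:E)%E.
  rewrite /g ge0_integral_normal_prob; last 2 first.
  - by apply/measurable_EFinP; apply: measurableT_comp.
  - by move=> x; rewrite lee_fin expR_ge0.
  transitivity (\int[@lebesgue_measure R]_x
      ((expR (m ^+ 2 / 2))%:E * (normal_pdf m 1 x)%:E))%E; last first.
    rewrite integralZl//; last exact: integrable_normal_pdf.
    by rewrite integral_normal_pdf mule1.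
  apply: eq_integral => x _; rewrite -!EFinM; congr EFin.
  rewrite !normal_pdfE ?oner_eq0//= mulrCA [RHS]mulrCA; congr (_ * _).
  by rewrite /normal_fun -!expRD expr1n; congr expR; field.
have mid : measurable_fun setT (fun x : measurableTypeR R => x%:E).
  exact/measurable_EFinP.
have intX : g.-integrable setT (fun x : measurableTypeR R => x%:E).
  apply/integrableP; split => //.
  apply: (@le_lt_trans _ _ (\int[g]_x (1%:E + (x ^+ 2)%:E))%E).
    apply: ge0_le_integral => //.
    - exact: measurableT_comp.
    - apply: emeasurable_funD => //.
      by apply/measurable_EFinP; exact: measurable_funX.
    - move=> x _; rewrite /= -EFinD lee_fin.
      rewrite ler_norml; have := sqr_ge0 (x - 1); have := sqr_ge0 (x + 1).
      have := sqr_ge0 x; rewrite !sqrrD => *; apply/andP; split; lra.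
  rewrite ge0_integralD//; last first.
  - by apply/measurable_EFinP; exact: measurable_funX.
  - by move=> x _; rewrite lee_fin sqr_ge0.
  by rewrite m2E integral_cst//= /g probability_setT mule1 -EFinD ltry.
pose e := fine (\int[g]_x x%:E)%E.
have eE : (\int[g]_x x%:E = e%:E)%E by rewrite fineK// integrable_fin_num.
(* For y = m^2 < 1, exp (y / 2) <= 1 / (1 - y / 2) <= 1 + y. *)
have key (m : R) : `|m| < 1 -> m * e <= m ^+ 2.
  move=> m1; have m2 : m ^+ 2 < 1 by rewrite -real_normK ?num_real// expr_lt1.
  have : (1 + m%:E * e%:E <= (expR (m ^+ 2 / 2))%:E)%E.
    have int1 : g.-integrable setT (fun x : measurableTypeR R => 1%E).
      by apply: finite_measure_integrable_cst.
    have intmX : g.-integrable setT (fun x : measurableTypeR R => m%:E * x%:E)%E.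
      exact: integrableZl.
    have -> : (1 + m%:E * e%:E = \int[g]_x (1 + m%:E * x%:E))%E.
      rewrite integralD// integralZl// eE integral_cst//= /g probability_setT.
      by rewrite mule1.
    rewrite -exp; apply: le_integral => //.
    - exact: integrableD.
    - apply/integrableP; split.
        by apply/measurable_EFinP; apply: measurableT_comp.
      under eq_integral do rewrite /= ger0_norm ?expR_ge0//.
      by rewrite exp ltry.
    - by move=> x _; rewrite -EFinM -EFinD lee_fin expR_ge1Dx.
  rewrite -EFinM -EFinD lee_fin => h.
  have : expR (m ^+ 2 / 2) * (1 - m ^+ 2 / 2) <= 1.
    rewrite -[leRHS](expRxMexpNx_1 (m ^+ 2 / 2)) ler_wpM2l ?expR_ge0//.
    exact: expR_ge1Dx.
  move: h; move: (expR _) => E h1 h2.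
  have k0 : 0 < 1 - m ^+ 2 / 2 by lra.
  have h3 : (1 + m * e) * (1 - m ^+ 2 / 2) <= 1.
    by apply: le_trans h2; rewrite ler_pM2r.
  rewrite leNgt; apply/negP => h4.
  have h5 : (1 + m ^+ 2) * (1 - m ^+ 2 / 2) < 1.
    by apply: lt_le_trans h3; rewrite ltr_pM2r// ltrD2l.
  have : 0 <= m ^+ 2 * (1 - m ^+ 2) by rewrite mulr_ge0 ?sqr_ge0// subr_ge0 ltW.
  by move: h5; move: (m ^+ 2) => y; lra.
rewrite eE; congr EFin; apply/eqP; rewrite eq_le; apply/andP; split.
  apply: (@le0_linear_bound _ _ 1) => t /andP[t0 t1].
  have := key t; rewrite gtr0_norm// => /(_ t1).
  by rewrite expr2 ler_pM2l// mulr1.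
rewrite -oppr_le0; apply: (@le0_linear_bound _ _ 1) => t /andP[t0 t1].
have := key (- t); rewrite normrN gtr0_norm// => /(_ t1).
by rewrite sqrrN expr2 mulNr -mulrN ler_pM2l// mulr1.
Qed.

End NormalMoments.

(** * The standard Gaussian vector: measurability and moments *)

Section GaussianVector.
Context {R : realType}.

(** Tuples carry the product sigma-algebra, so an open set is exhausted by countably many boxes with
    rational centre and radius. *)
Lemma measurable_open_tuple n (O : set 'rV[R]_n) : open O ->
  measurable ((@vec_of_tuple R n) @^-1` O : set (n.-tuple (measurableTypeR R))).
Proof.
move=> oO.
pose box (p : 'rV[rat]_n * rat) : set 'rV[R]_n :=
  [set y | forall i, `|ratr (p.1 0 i) - y 0 i| < ratr p.2].
pose F (p : 'rV[rat]_n * rat) : set (n.-tuple (measurableTypeR R)) :=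
  [set u | box p `<=` O /\ box p (vec_of_tuple u)].
have -> : (@vec_of_tuple R n) @^-1` O = \bigcup_p F p.
  apply/seteqP; split => [u /= Ou|u [p _ [pO pu]]]; last exact: pO.
  set x := vec_of_tuple u in Ou *.
  have /nbhs_ballP[e /= e0 xeO] : nbhs x O by exact: open_nbhs_nbhs.
  have [q] : exists q : rat, ratr q \in `]0, e / 2[%R.
    by apply: rat_in_itvoo; rewrite divr_gt0.
  rewrite in_itv/= => /andP[q0 qe].
  (* A rational centre within q of x in each coordinate, with q < e / 2: the box of radius q
     contains x and lies within e of it. *)
  have /choice[c cP] : forall i : 'I_n, exists r : rat, `|ratr r - x 0 i| < ratr q.
    move=> i; have [r] : exists r : rat, ratr r \in `](x 0 i - ratr q), (x 0 i + ratr q)[%R.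
      by apply: rat_in_itvoo; rewrite ltrBlDr -addrA ltrDl addr_gt0.
    by rewrite in_itv/= => h; exists r; rewrite ltr_distl.
  exists (\row_i c i, q) => //; split; last by move=> i /=; rewrite mxE.
  move=> y yb; apply: xeO; split => // j i; rewrite ord1 /ball/=.
  have /= := yb i; rewrite mxE => h.
  apply: le_lt_trans (ler_distD (ratr (c i)) _ _) _.
  by rewrite (splitr e) ltrD// (lt_trans _ qe)// distrC.
apply: countable_bigcupT_measurable; first exact: countableP.
move=> p; have [pO|npO] := pselect (box p `<=` O); last first.
  rewrite (_ : F p = set0); first by apply: sigma_algebra0.
  by apply/seteqP; split => // u [].
rewrite (_ : F p = \bigcap_(i in [set: 'I_n])
    ((fun u : n.-tuple (measurableTypeR R) => tnth u i) @^-1`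
      ball (ratr (p.1 0 i) : R) (ratr p.2))).
  apply: fin_bigcap_measurable => // i _; rewrite -[X in measurable X]setTI.
  apply: measurable_tnth => //.
  by apply: open_measurable; exact: ball_open.
apply/seteqP; split => u /=.
  by move=> [_ h] i _; have := h i; rewrite mxE.
by move=> h; split => // i; rewrite mxE; exact: h.
Qed.

Lemma measurable_continuous_tuple n (F : 'rV[R]_n -> R) : continuous F ->
  measurable_fun setT (fun u : n.-tuple (measurableTypeR R) => F (vec_of_tuple u)).
Proof.
move=> /continuousP cF; apply: (measurability _ (RGenOpens.measurableE R)).
move=> _ [_ [a [b ->] <-]]; rewrite setTI.
by apply: (@measurable_open_tuple n (F @^-1` `]a, b[%classic)); exact/cF/interval_open.
Qed.

Let T n := n.-tuple (measurableTypeR R).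

Lemma ge0_integral_gaussianS n (F : T n.+1 -> \bar R) :
  measurable_fun setT F -> (forall u, (0 <= F u)%E) ->
  (\int[std_gaussian R n.+1]_u F u =
   \int[normal_prob (0 : R) 1]_x \int[std_gaussian R n]_u F (cons_pair (x, u)))%E.
Proof.
move=> mF F0; rewrite /= ge0_integral_distribution//=.
by rewrite fubini_tonelli1//; exact: measurableT_comp.
Qed.

Lemma integral_gaussianS n (F : T n.+1 -> \bar R) :
  (std_gaussian R n.+1).-integrable setT F ->
  (\int[std_gaussian R n.+1]_u F u =
   \int[normal_prob (0 : R) 1]_x \int[std_gaussian R n]_u F (cons_pair (x, u)))%E.
Proof.
move=> intF; have mF := measurable_int _ intF.
have intFc : (normal_prob (0 : R) 1 \x std_gaussian R n)%E.-integrable setT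
    (F \o @cons_pair R n).
  apply/integrableP; split; first exact: measurableT_comp.
  have /integrableP[_] := intF; rewrite /= ge0_integral_distribution//=.
  exact: measurableT_comp.
by rewrite /= integral_distribution//= -integral12_prod_meas1.
Qed.

Definition sqnorm n (u : T n) : R := \sum_i tnth u i ^+ 2.

Lemma sqnormE n (u : T n) : sqnorm u = mxdot (vec_of_tuple u) (vec_of_tuple u).
Proof. by rewrite mxdotE big_ord1; apply: eq_bigr => i _; rewrite mxE expr2. Qed.

Lemma sqnorm_cons n x (u : T n) : sqnorm (cons_pair (x, u)) = x ^+ 2 + sqnorm u.
Proof.
rewrite /sqnorm big_ord_recl; congr (_ + _).
by apply: eq_bigr => i _; rewrite tnthS.
Qed.

Lemma sqnorm_ge0 n (u : T n) : 0 <= sqnorm u.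
Proof. by apply: sumr_ge0 => i _; rewrite sqr_ge0. Qed.

Lemma measurable_sqnorm n : measurable_fun setT (@sqnorm n).
Proof.
apply: measurable_sum => i; apply: measurable_funX.
exact: measurable_tnth.
Qed.

Lemma gaussian_sqnorm n : (\int[std_gaussian R n]_u (sqnorm u)%:E = n%:R%:E)%E.
Proof.
have [m4 _ [m2 _]] := @normal_moment24 R.
elim: n => [|n IH].
  by rewrite integral0_eq// => u _; rewrite /sqnorm big_ord0.
rewrite ge0_integral_gaussianS; last 2 first.
- by apply/measurable_EFinP; exact: measurable_sqnorm.
- by move=> u; rewrite lee_fin sqnorm_ge0.
transitivity (\int[normal_prob (0 : R) 1]_x ((x ^+ 2)%:E + n%:R%:E))%E.
  apply: eq_integral => x _.
  under eq_integral do rewrite sqnorm_cons EFinD.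
  rewrite ge0_integralD//; last 3 first.
  - by move=> u _; rewrite lee_fin sqr_ge0.
  - by move=> u _; rewrite lee_fin sqnorm_ge0.
  - by apply/measurable_EFinP; exact: measurable_sqnorm.
  by rewrite IH integral_cst//= probability_setT mule1.
rewrite ge0_integralD//; last 2 first.
- by move=> x _; rewrite lee_fin sqr_ge0.
- by apply/measurable_EFinP; exact: measurable_funX.
by rewrite m2 integral_cst//= probability_setT mule1 -EFinD -natr1 addrC.
Qed.

End GaussianVector.

Section GaussianMoments.
Context {R : realType}.
Let T n := n.-tuple (measurableTypeR R).

(** Splitting off one coordinate x from (x^2 + |u|^2)^2 gives the recursion M' = m4 + 2 n + M. With
    m4 <= 3 the bound n^2 + 2 n propagates, its increment being 2 n + 3. *)
Lemma gaussian_sqnorm_sqr n : exists2 M : R, M <= n%:R ^+ 2 + 2 * n%:R &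
  (\int[std_gaussian R n]_u (sqnorm u ^+ 2)%:E = M%:E)%E.
Proof.
have [m4 m4le3 [m2 m4E]] := @normal_moment24 R.
have mS k m : measurable_fun setT (fun u : T m => (sqnorm u ^+ k)%:E).
  by apply/measurable_EFinP; apply: measurable_funX; exact: measurable_sqnorm.
elim: n => [|n [M Mle IH]].
  exists 0; first by rewrite expr0n/= mulr0 addr0.
  by rewrite integral0_eq// => u _; rewrite /sqnorm big_ord0 expr0n.
exists (m4 + (2 * n%:R + M)).
  by rewrite -(natr1 n); move: (n%:R) Mle => k; lra.
rewrite ge0_integral_gaussianS//; last by move=> u; rewrite lee_fin sqr_ge0.
transitivity (\int[normal_prob (0 : R) 1]_x
    ((x ^+ 4)%:E + ((2 * n%:R)%:E * (x ^+ 2)%:E + M%:E)))%E.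
  apply: eq_integral => x _.
  transitivity (\int[std_gaussian R n]_u ((x ^+ 4)%:E +
     ((2 * x ^+ 2)%:E * (sqnorm u)%:E + (sqnorm u ^+ 2)%:E)))%E.
    apply: eq_integral => u _; rewrite sqnorm_cons -!EFinM -!EFinD; congr EFin; ring.
  have mS1 := mS 1%N n; have mS2 := mS 2%N n.
  have x0 : 0 <= 2 * x ^+ 2 by rewrite mulr_ge0// sqr_ge0.
  have p1 (u : T n) : (0 <= (2 * x ^+ 2)%:E * (sqnorm u)%:E)%E.
    by rewrite mule_ge0// lee_fin sqnorm_ge0.
  have p2 (u : T n) : (0 <= (sqnorm u ^+ 2)%:E)%E by rewrite lee_fin sqr_ge0.
  have q1 : measurable_fun setT (fun u : T n => (2 * x ^+ 2)%:E * (sqnorm u)%:E)%E.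
    exact: measurable_funeM.
  rewrite ge0_integralD//; last 3 first.
  - by move=> u _; rewrite lee_fin exprn_even_ge0.
  - by move=> u _; rewrite adde_ge0.
  - exact: emeasurable_funD.
  rewrite ge0_integralD// ge0_integralZl_EFin//; last first.
    by move=> u _; rewrite lee_fin sqnorm_ge0.
  rewrite gaussian_sqnorm IH integral_cst//= probability_setT mule1 -!EFinM -!EFinD.
  by congr EFin; ring.
have n0 : 0 <= 2 * n%:R :> R by rewrite mulr_ge0.
have M0 : 0 <= M.
  by rewrite -lee_fin -IH integral_ge0// => u _; rewrite lee_fin sqr_ge0.
have mX k : measurable_fun setT (fun x : measurableTypeR R => (x ^+ k)%:E).
  by apply/measurable_EFinP; exact: measurable_funX.
have p2 (x : R) : (0 <= (2 * n%:R)%:E * (x ^+ 2)%:E)%E.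
  by rewrite mule_ge0// lee_fin sqr_ge0.
have q2 : measurable_fun setT (fun x : measurableTypeR R => (2 * n%:R)%:E * (x ^+ 2)%:E)%E.
  exact: measurable_funeM.
rewrite ge0_integralD//; last 3 first.
- by move=> x _; rewrite lee_fin exprn_even_ge0.
- by move=> x _; rewrite adde_ge0.
- exact: emeasurable_funD.
rewrite ge0_integralD// ge0_integralZl_EFin//; last by move=> x _; rewrite lee_fin sqr_ge0.
by rewrite m4E m2 integral_cst//= probability_setT !mule1 -!EFinD.
Qed.

Lemma gaussian_integrable n (F : T n -> R) (C : R) : measurable_fun setT F ->
  (forall u, `|F u| <= C * (1 + sqnorm u ^+ 2)) ->
  (std_gaussian R n).-integrable setT (EFin \o F).
Proof.
move=> mF Fle; have [M _ IM] := gaussian_sqnorm_sqr n.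
have mS : measurable_fun setT (fun u : T n => (sqnorm u ^+ 2)%:E).
  by apply/measurable_EFinP; apply: measurable_funX; exact: measurable_sqnorm.
have S0 (u : T n) : (0 <= (sqnorm u ^+ 2)%:E)%E by rewrite lee_fin sqr_ge0.
apply/integrableP; split; first exact/measurable_EFinP.
pose C' := Num.max C 0.
apply: (@le_lt_trans _ _ (\int[std_gaussian R n]_u (C'%:E * (1 + (sqnorm u ^+ 2)%:E)))%E).
  apply: ge0_le_integral => //.
  - by apply: measurableT_comp => //; exact/measurable_EFinP.
  - by apply: measurable_funeM; exact: emeasurable_funD.
  - move=> u _; rewrite -EFinD -EFinM lee_fin; apply: le_trans (Fle u) _.
    by rewrite ler_wpM2r ?le_max ?lexx// addr_ge0// sqr_ge0.
rewrite ge0_integralZl_EFin//; last 3 first.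
- by move=> u _; rewrite adde_ge0.
- exact: emeasurable_funD.
- by rewrite le_max lexx orbT.
rewrite ge0_integralD// IM integral_cst//= probability_setT mule1.
by rewrite -EFinD -EFinM ltry.
Qed.

Lemma sqr_tnth_le n (u : T n) i : tnth u i ^+ 2 <= sqnorm u.
Proof. by rewrite /sqnorm (bigD1 i)//= lerDl sumr_ge0// => j _; rewrite sqr_ge0. Qed.

Lemma normM_tnth_le n (u : T n) i j : `|tnth u i * tnth u j| <= sqnorm u.
Proof.
have := sqr_tnth_le u i; have := sqr_tnth_le u j.
rewrite normrM -[tnth u i ^+ 2]real_normK ?num_real//.
rewrite -[tnth u j ^+ 2]real_normK ?num_real//.
have := sqr_ge0 (`|tnth u i| - `|tnth u j|); rewrite sqrrB.
by move: `|tnth u i| `|tnth u j| (sqnorm u) => a b c; lra.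
Qed.

Lemma integrable_tnthM n i j : (std_gaussian R n).-integrable setT
  (fun u : T n => (tnth u i * tnth u j)%:E).
Proof.
apply: (@gaussian_integrable _ _ 1).
  by apply: measurable_funM; exact: measurable_tnth.
move=> u; rewrite mul1r; apply: le_trans (normM_tnth_le _ _ _) _.
by have := sqr_ge0 (sqnorm u - 1); rewrite sqrrB; have := sqnorm_ge0 u; nra.
Qed.

Lemma integrable_tnth n i : (std_gaussian R n).-integrable setT
  (fun u : T n => (tnth u i)%:E).
Proof.
apply: (@gaussian_integrable _ _ 2); first exact: measurable_tnth.
move=> u; have := sqr_tnth_le u i; rewrite -[tnth u i ^+ 2]real_normK ?num_real//.
have := sqr_ge0 (sqnorm u - 1); have := sqr_ge0 (`|tnth u i| - 1).
have := sqr_ge0 (sqnorm u).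
by rewrite !sqrrB; move: `|tnth u i| (sqnorm u) => a b; lra.
Qed.

Lemma gaussian_moment1 n (i : 'I_n) : (\int[std_gaussian R n]_u (tnth u i)%:E = 0)%E.
Proof.
elim: n i => [[]//|n IH i]; rewrite integral_gaussianS; last exact: integrable_tnth.
case: (unliftP ord0 i) => [j ->|->] /=.
  under eq_integral do under eq_integral do rewrite tnthS.
  by under eq_integral do rewrite IH; rewrite integral0.
rewrite -[RHS](@normal_moment1 R); apply: eq_integral => x _.
rewrite (_ : (fun _ => _) = cst x%:E); last by apply/funext => u; rewrite (tnth_nth 0).
by rewrite integral_cst//= probability_setT mule1.
Qed.

Lemma gaussian_moment2 n (i j : 'I_n) :
  (\int[std_gaussian R n]_u (tnth u i * tnth u j)%:E = (i == j)%:R%:E)%E.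
Proof.
have [m4 _ [m2 _]] := @normal_moment24 R.
elim: n i j => [[]//|n IH i j]; rewrite integral_gaussianS; last exact: integrable_tnthM.
have cross x (k : 'I_n) : (\int[std_gaussian R n]_u (x * tnth u k)%:E = 0)%E.
  under eq_integral do rewrite EFinM.
  by rewrite integralZl//; [rewrite gaussian_moment1 mule0|exact: integrable_tnth].
have t0 x (u : T n) : tnth (cons_pair (x, u)) ord0 = x by rewrite (tnth_nth 0).
case: (unliftP ord0 i) => [i' ->|->]; case: (unliftP ord0 j) => [j' ->|->].
- under eq_integral do under eq_integral do rewrite !tnthS.
  under eq_integral do rewrite IH.
  rewrite integral_cst//= probability_setT mule1.
  by rewrite (inj_eq lift_inj).
- under eq_integral do under eq_integral do rewrite tnthS t0 mulrC.
  by under eq_integral do rewrite cross; rewrite integral0.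
- under eq_integral do under eq_integral do rewrite tnthS t0.
  by under eq_integral do rewrite cross; rewrite integral0.
- rewrite eqxx -m2; apply: eq_integral => x _.
  under eq_integral do rewrite t0 -expr2.
  by rewrite integral_cst//= probability_setT mule1.
Qed.

End GaussianMoments.

(** * Expectations of forms and comparison of means *)

Section GaussianMean.
Context {R : realType}.
Let T n := n.-tuple (measurableTypeR R).

Lemma mxdot_vec_of_tuple n (g : 'rV[R]_n) (u : T n) :
  mxdot g (vec_of_tuple u) = \sum_i g 0 i * tnth u i.
Proof. by rewrite mxdotE big_ord1; apply: eq_bigr => i _; rewrite mxE. Qed.

Lemma quad_vec_of_tuple n (A : 'M[R]_n) (u : T n) :
  mxdot (vec_of_tuple u *m A) (vec_of_tuple u) =
  \sum_i \sum_j A i j * (tnth u i * tnth u j).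
Proof.
rewrite mxdotE big_ord1 exchange_big/=; apply: eq_bigr => j _.
rewrite mxE mulr_suml; apply: eq_bigr => i _.
by rewrite !mxE mulrAC mulrC.
Qed.

Lemma gaussian_integral_linear n (g : 'rV[R]_n) :
  (std_gaussian R n).-integrable setT (fun u => (mxdot g (vec_of_tuple u))%:E) /\
  (\int[std_gaussian R n]_u (mxdot g (vec_of_tuple u))%:E = 0)%E.
Proof.
have E (u : T n) : ((mxdot g (vec_of_tuple u))%:E =
    \sum_i (g 0 i)%:E * (tnth u i)%:E)%E.
  by rewrite mxdot_vec_of_tuple -sumEFin.
have int i : (std_gaussian R n).-integrable setT
    (fun u : T n => (g 0 i)%:E * (tnth u i)%:E)%E.
  by apply: integrableZl => //; exact: integrable_tnth.
split.
  rewrite (_ : (fun _ => _) = (fun u : T n => \sum_i (g 0 i)%:E * (tnth u i)%:E)%E).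
    exact: integrable_sum.
  exact/funext.
under eq_integral do rewrite E; rewrite integral_sum// big1// => i _.
by rewrite integralZl//; [rewrite gaussian_moment1 mule0|exact: integrable_tnth].
Qed.

Lemma gaussian_integral_quadratic n (A : 'M[R]_n) :
  (std_gaussian R n).-integrable setT
    (fun u => (mxdot (vec_of_tuple u *m A) (vec_of_tuple u))%:E) /\
  (\int[std_gaussian R n]_u (mxdot (vec_of_tuple u *m A) (vec_of_tuple u))%:E
    = (\tr A)%:E)%E.
Proof.
have E (u : T n) : ((mxdot (vec_of_tuple u *m A) (vec_of_tuple u))%:E =
    \sum_i \sum_j (A i j)%:E * (tnth u i * tnth u j)%:E)%E.
  by rewrite quad_vec_of_tuple -sumEFin; apply: eq_bigr => i _; rewrite -sumEFin.
have int i j : (std_gaussian R n).-integrable setT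
    (fun u : T n => (A i j)%:E * (tnth u i * tnth u j)%:E)%E.
  by apply: integrableZl => //; exact: integrable_tnthM.
have ints i : (std_gaussian R n).-integrable setT
    (fun u : T n => \sum_j (A i j)%:E * (tnth u i * tnth u j)%:E)%E.
  exact: integrable_sum.
split.
  rewrite (_ : (fun _ => _) = (fun u : T n =>
      \sum_i \sum_j (A i j)%:E * (tnth u i * tnth u j)%:E)%E).
    exact: integrable_sum.
  exact/funext.
under eq_integral do rewrite E; rewrite integral_sum// /mxtrace -sumEFin.
apply: eq_bigr => i _; rewrite integral_sum// (bigD1 i)//= big1 => [|j ji].
  rewrite integralZl//; last exact: integrable_tnthM.
  by rewrite gaussian_moment2 eqxx mule1 adde0.
rewrite integralZl//; last exact: integrable_tnthM.
by rewrite gaussian_moment2 eq_sym (negbTE ji) mule0.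
Qed.

Lemma integrable_continuous n (F : 'rV[R]_n -> R) (C : R) : continuous F ->
  (forall v, `|F v| <= C * (1 + mxdot v v ^+ 2)) ->
  (std_gaussian R n).-integrable setT (fun u => (F (vec_of_tuple u))%:E).
Proof.
move=> cF FC; apply: (@gaussian_integrable _ _ _ C).
  exact: measurable_continuous_tuple.
by move=> u; rewrite sqnormE; exact: FC.
Qed.

(** Integrates a pointwise bound: the linear term has mean 0, the quadratic one gives the trace, and
    the quartic one is controlled by the fourth moment. All later estimates reach the expectation
    through this inequality. *)
Lemma gaussian_mean_diff_ge n (F G : 'rV[R]_n -> R) (a c C C' : R) g A :
  continuous F -> continuous G -> 0 <= c ->
  (forall v, `|F v| <= C * (1 + mxdot v v ^+ 2)) ->
  (forall v, `|G v| <= C' * (1 + mxdot v v ^+ 2)) ->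
  (forall v, a + mxdot g v + mxdot (v *m A) v - c * mxdot v v ^+ 2 <= F v - G v) ->
  a + \tr A - c * (n%:R ^+ 2 + 2 * n%:R) <=
  fine 'E_(std_gaussian R n)[fun u => F (vec_of_tuple u)]%E
  - fine 'E_(std_gaussian R n)[fun u => G (vec_of_tuple u)]%E.
Proof.
move=> cF cG c0 FC GC FG; rewrite unlock.
have iF := integrable_continuous cF FC; have iG := integrable_continuous cG GC.
rewrite -fineB ?integrable_fin_num// -integralB//.
have [M Mle IM] := @gaussian_sqnorm_sqr R n.
have [i1 e1] := gaussian_integral_linear g; have [i2 e2] := gaussian_integral_quadratic A.
have i3 : (std_gaussian R n).-integrable setT
    (fun u : T n => (- c)%:E * (sqnorm u ^+ 2)%:E)%E.
  apply: integrableZl => //; apply: (@gaussian_integrable _ _ _ 1).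
    by apply: measurable_funX; exact: measurable_sqnorm.
  by move=> u; rewrite mul1r ger0_norm ?sqr_ge0// lerDr.
have i0 : (std_gaussian R n).-integrable setT (fun u : T n => a%:E).
  exact: finite_measure_integrable_cst.
have e3 : (\int[std_gaussian R n]_u ((- c)%:E * (sqnorm u ^+ 2)%:E) = (- c * M)%:E)%E.
  rewrite integralZl ?IM//; apply: (@gaussian_integrable _ _ _ 1).
    by apply: measurable_funX; exact: measurable_sqnorm.
  by move=> u; rewrite mul1r ger0_norm ?sqr_ge0// lerDr.
have i01 := integrableD measurableT i0 i1.
have i012 := integrableD measurableT i01 i2.
have i0123 := integrableD measurableT i012 i3.
apply: (@le_trans _ _ (a + \tr A - c * M)).
  by rewrite lerD2l lerN2 ler_wpM2l.
have -> : a + \tr A - c * M = fine (\int[std_gaussian R n]_u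
   (a%:E + (mxdot g (vec_of_tuple u))%:E +
     (mxdot (vec_of_tuple u *m A) (vec_of_tuple u))%:E +
     (- c)%:E * (sqnorm u ^+ 2)%:E)%E).
  rewrite integralD// integralD// integralD// e1 e2 e3.
  by rewrite integral_cst//= probability_setT mule1 adde0 -!EFinD/= mulNr.
apply: fine_le; rewrite ?integrable_fin_num//; first exact: integrableB.
apply: le_integral => //; first exact: integrableB.
move=> u _; rewrite -EFinM -!EFinD lee_fin mulNr sqnormE; exact: FG.
Qed.

End GaussianMean.

(** * Comparison with the quadratic model *)

Section Bounds.
Context {R : realType}.

(** The argument produces 6 s with s^2 = q = d^2 + 2 d. One s is covered by d q^(3/4), since q >= 1.
    The other five are covered by the first term: its base is (d + 4) q >= 5 q, and the sixth powers
    compare as 5^6 q^3 <= 5^5 q^5 because q >= 3. *)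
Lemma dim_const_ge (d : nat) : (0 < d)%N ->
  6 * Num.sqrt (d%:R ^+ 2 + 2 * d%:R) <= dim_const d :> R.
Proof.
move=> d0; have d1 : 1 <= d%:R :> R by rewrite ler1n.
rewrite /dim_const; set k : R := d%:R in d1 *.
set q := k ^+ 2 + 2 * k; set s := Num.sqrt q.
have kk : k <= k ^+ 2 by rewrite expr2 ler_peMl// (le_trans ler01).
have q3 : 3 <= q by rewrite /q; lra.
have q0 : 0 <= q by rewrite (le_trans _ q3).
have s2 : s ^+ 2 = q by rewrite sqr_sqrtr.
have s0 : 0 <= s by exact: sqrtr_ge0.
have h1 : s <= k * q `^ (3 / 4).
  have h : s <= q `^ (3 / 4).
    rewrite /s -powR12_sqrt//; apply: ler_powR; first by rewrite (le_trans _ q3)// ler1n.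
    by lra.
  by apply: le_trans h _; rewrite ler_peMl// powR_ge0.
have h2 : 5 * s <= (k ^+ 3 + 6 * k ^+ 2 + 8 * k) `^ (5 / 6).
  set x := _ + 8 * k.
  have xE : x = (k + 4) * q by rewrite /x /q; ring.
  have x0 : 0 <= x by rewrite xE mulr_ge0// addr_ge0// (le_trans ler01).
  have x5 : 5 * q <= x by rewrite xE ler_wpM2r// -lerBlDr; lra.
  have p6 : (x `^ (5 / 6)) ^+ 6 = x ^+ 5.
    rewrite -powR_mulrn ?powR_ge0// -powRrM -powR_mulrn//.
    by congr powR; field.
  rewrite -(@ler_pXn2r _ 6) ?nnegrE ?mulr_ge0 ?powR_ge0// p6.
  apply: (@le_trans _ _ ((5 * q) ^+ 5)); last by rewrite ler_pXn2r ?nnegrE ?mulr_ge0.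
  have -> : (5 * s) ^+ 6 = 5 ^+ 5 * 5 * (s ^+ 2) ^+ 3 by ring.
  have -> : (5 * q) ^+ 5 = 5 ^+ 5 * q ^+ 2 * q ^+ 3 by ring.
  rewrite s2; apply: ler_wpM2r; first by rewrite exprn_ge0.
  apply: ler_wpM2l; first by rewrite exprn_ge0.
  by rewrite expr2; nra.
lra.
Qed.

Lemma powR32 (x : R) : 0 <= x -> x `^ (3 / 2) = Num.sqrt x ^+ 3.
Proof.
move=> x0; rewrite -powR12_sqrt// -powR_mulrn ?powR_ge0// -powRrM.
by congr powR; field.
Qed.

Lemma continuous_affine (d : nat) (mu : 'rV[R]_d) (alpha : R) (B : 'M[R]_d) :
  continuous (fun v : 'rV[R]_d => mu + alpha *: (v *m B)).
Proof.
have cD (g h : 'rV[R]_d -> 'rV[R]_d) : continuous g -> continuous h ->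
    continuous (fun v => g v + h v).
  by move=> cg ch v; exact: (continuousD (cg v) (ch v)).
have cB : continuous (fun v : 'rV[R]_d => v *m B).
  rewrite (_ : (fun _ => _) = (fun v : 'rV[R]_d => \sum_i v 0 i *: row i B)); last first.
    by apply/funext => v; rewrite mulmx_sum_row.
  elim: (index_enum _) => [|i r IH].
    rewrite (_ : (fun _ => _) = cst 0); last by apply/funext => v; rewrite big_nil.
    exact: cst_continuous.
  rewrite (_ : (fun _ => _) =
    (fun v : 'rV[R]_d => v 0 i *: row i B + \sum_(j <- r) v 0 j *: row j B)); last first.
    by apply/funext => v; rewrite big_cons.
  apply: cD IH => v; apply: continuousZr_tmp; exact: coord_continuous.
apply: cD; first by move=> v; exact: cst_continuous.
by move=> v; exact: (continuousZl_tmp (k := alpha) (cB v)).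
Qed.

Lemma loewner_unitmx (n : nat) (H : 'M[R]_n) (sigma : R) : H^T = H -> 0 < sigma ->
  loewner_le sigma%:M H -> H \in unitmx.
Proof.
move=> Hs s0 Hge; have [U UU [h HE]] := spectral_symmetric Hs.
rewrite -/(spec U h) in HE.
have sh : forall i, sigma <= h 0 i by apply/(loewner_ge_spec UU); rewrite -HE.
rewrite unitmxE HE det_spec// unitfE; apply/prodf_neq0 => i _.
by rewrite gt_eqF// (lt_le_trans s0).
Qed.

Lemma frob_invmx_mul_le (n : nat) (H X : 'M[R]_n) (sigma : R) : H^T = H -> 0 < sigma ->
  loewner_le sigma%:M H -> sigma * frob (X *m invmx H) <= frob X.
Proof.
move=> Hs s0 Hge; have Hu := loewner_unitmx Hs s0 Hge.
set Y := X *m invmx H; have XE : X = Y *m H by rewrite /Y mulmxKV.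
have [->|Y0] := eqVneq Y 0; first by rewrite frob0 mulr0 frob_ge0.
have fY : 0 < frob Y by rewrite lt_neqAle eq_sym frob_eq0 Y0 frob_ge0.
rewrite -(ler_pM2r fY) -mulrA -expr2 frob_sqr XE.
by apply: le_trans (mxdot_quad_ge _ Hs Hge) (mxdot_ler _ _).
Qed.

(** H^-1 - K^-1 = K^-1 (K - H) H^-1, and multiplying by either inverse shrinks the Frobenius norm by
    sigma. *)
Lemma frob_invmxB_le (n : nat) (H K : 'M[R]_n) (sigma : R) :
  H^T = H -> K^T = K -> 0 < sigma -> loewner_le sigma%:M H -> loewner_le sigma%:M K ->
  frob (invmx H - invmx K) <= frob (H - K) / sigma ^+ 2.
Proof.
move=> Hs Ks s0 Hge Kge.
have Hu := loewner_unitmx Hs s0 Hge; have Ku := loewner_unitmx Ks s0 Kge.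
have -> : invmx H - invmx K = invmx K *m (K - H) *m invmx H.
  by rewrite mulmxBr mulVmx// mulmxBl mul1mx -mulmxA mulmxV// mulmx1.
rewrite ler_pdivlMr ?exprn_gt0// mulrC expr2 -mulrA frobBC.
set X := invmx K *m (K - H).
have h1 : sigma * frob (X *m invmx H) <= frob X by exact: frob_invmx_mul_le.
apply: le_trans (ler_wpM2l (ltW s0) h1) _.
rewrite -frob_tr /X trmx_mul trmx_inv Ks -(frob_tr (K - H)).
exact: frob_invmx_mul_le.
Qed.

End Bounds.

(** * Comparing two values of the objective *)

Section Objective.
Context {R : realType} {d : nat} {f : 'rV[R]_d -> R} {L sigma gamma alpha tau zeta : R}.
Hypotheses (alpha0 : 0 < alpha) (tau0 : 0 < tau) (tau_zeta : tau <= zeta).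
Hypotheses (sigma0 : 0 < sigma) (gamma0 : 0 < gamma) (d0 : (0 < d)%N).
Hypotheses (fdiff : twice_differentiable f) (fsmooth : smooth L f).
Hypotheses (fconvex : strongly_convex sigma f) (fhess : lipschitz_hessian gamma f).
Implicit Types (mu v : 'rV[R]_d) (B S : 'M[R]_d).

Lemma smooth_ge0 : 0 <= L.
Proof.
have [i] : exists i : 'I_d, true by exists (Ordinal d0).
move=> _; pose x : 'rV[R]_d := delta_mx 0 i.
have x0 : x - 0 != 0.
  by rewrite subr0; apply/eqP => /rowP/(_ i); rewrite !mxE !eqxx => /eqP; rewrite oner_eq0.
have fx : 0 < frob (x - 0) by rewrite lt_neqAle eq_sym frob_eq0 x0 frob_ge0.
by rewrite -(pmulr_lge0 _ fx) (le_trans (frob_ge0 _) (fsmooth x 0)).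
Qed.

(** f lies between two quadratics, and 1 + |v|^4 dominates both |v| and |v|^2; this supplies
    integrability. *)
Lemma affine_growth mu B : exists C,
  forall v, `|f (mu + alpha *: (v *m B))| <= C * (1 + mxdot v v ^+ 2).
Proof.
pose k := alpha ^+ 2 * mxdot B B.
have k0 : 0 <= k by rewrite mulr_ge0 ?sqr_ge0 ?mxdot_ge0.
have L0 := smooth_ge0.
set gr := gradient f mu.
exists (`|f mu| + frob gr * (1 + k) + L * k) => v; set x := alpha *: (v *m B).
have xk : frob x ^+ 2 <= k * mxdot v v.
  rewrite /x frobZ exprMn real_normK ?num_real// /k -mulrA ler_wpM2l ?sqr_ge0//.
  by rewrite frob_sqr mulrC row_frob_sqr_le_frobM.
have [W WE] : exists W, W = 1 + mxdot v v ^+ 2 by eexists.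
rewrite -WE; have W1 : 1 <= W by rewrite WE lerDl sqr_ge0.
have vW : mxdot v v <= W.
  have := sqr_ge0 (mxdot v v - 1); rewrite sqrrB WE; have := mxdot_ge0 v.
  by move: (mxdot v v) => w; lra.
have kW0 : 0 <= k * W by rewrite mulr_ge0// (le_trans ler01).
have xW : frob x ^+ 2 <= k * W by apply: le_trans xk _; rewrite ler_wpM2l.
have x1 : frob x <= (1 + k) * W.
  by have := sqr_ge0 (frob x - 1); rewrite sqrrB; move: (frob x) xW => X; lra.
have up := convex_upper_bound sigma0 fsmooth fconvex mu x.
have lo := convex_lower_bound fconvex mu x.
have s0 : 0 <= sigma / 2 * frob x ^+ 2 by rewrite mulr_ge0 ?sqr_ge0// divr_ge0// ltW.
have := mxdot_le gr x; rewrite ler_norml => /andP[g1 g2].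
have G1 : frob gr * frob x <= frob gr * ((1 + k) * W).
  by rewrite ler_wpM2l ?frob_ge0.
have L1 : L * frob x ^+ 2 <= L * (k * W) by rewrite ler_wpM2l.
have F1 : `|f mu| <= `|f mu| * W by rewrite ler_peMr.
have K1 : 0 <= L * (k * W) by rewrite mulr_ge0.
have f1 := ler_norm (f mu); have f2 := ler_norm (- f mu); rewrite normrN in f2.
have scal (p N NW A P Q G K Fx : R) : p + A <= Fx -> Fx <= p + A + P ->
    - Q <= A -> A <= Q -> Q <= G -> P <= K -> N <= NW -> 0 <= K -> p <= N -> - p <= N ->
    `|Fx| <= NW + G + K.
  by move=> *; rewrite ler_norml; apply/andP; split; lra.
have -> : (`|f mu| + frob gr * (1 + k) + L * k) * W =
    `|f mu| * W + frob gr * ((1 + k) * W) + L * (k * W) by ring.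

by apply: (scal _ _ _ _ _ _ _ _ _ _ up g1 g2 G1 L1 F1 K1 f1 f2); apply: le_trans lo; rewrite lerDl.
Qed.

(** Both arguments may vary: it serves for two covariances at one location and for two locations at
    one covariance. *)
Lemma Qalpha_diff_ge mu nu S B' a c g A :
  0 <= c ->
  (forall v, a + mxdot g v + mxdot (v *m A) v - c * mxdot v v ^+ 2 <=
     f (mu + alpha *: (v *m sqrtmx S)) - f (nu + alpha *: (v *m sqrtmx B'))) ->
  a + \tr A - c * (d%:R ^+ 2 + 2 * d%:R)
   - alpha ^+ 2 / 2 * (ln (\det S) - ln (\det B')) <=
  Qalpha f alpha mu S - Qalpha f alpha nu B'.
Proof.
move=> c0 h; have cf := continuous_f fdiff.
have [C1 h1] := affine_growth mu (sqrtmx S).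
have [C2 h2] := affine_growth nu (sqrtmx B').
have cF (m : 'rV[R]_d) (B : 'M[R]_d) : continuous (fun v => f (m + alpha *: (v *m B))).
  by move=> v; apply: continuous_comp; [exact: continuous_affine|exact: cf].
have := gaussian_mean_diff_ge (cF mu (sqrtmx S)) (cF nu (sqrtmx B')) c0 h1 h2 h.
rewrite /Qalpha; move: (fine _) (fine _) => E1 E2.
by move: (ln _) (ln _) (\tr A) => l1 l2 t; lra.
Qed.

Lemma mxdot_self_mul (v : 'rV[R]_d) (M : 'M[R]_d) :
  mxdot (v *m M) (v *m M) = mxdot (v *m (M *m M^T)) v.
Proof. by rewrite mulmxA [RHS]mxdot_mull trmxK. Qed.

Lemma frob_sqr_cov v S : cov_set tau zeta S ->
  frob (alpha *: (v *m sqrtmx S)) ^+ 2 <= alpha ^+ 2 / tau * mxdot v v.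
Proof.
move=> Scov; have [V VV [k [sE SE _ _]]] := sqrtmx_cov_spec tau0 tau_zeta Scov.
have [Ss _ Sle] := Scov.
rewrite frobZ exprMn real_normK ?num_real// -mulrA ler_wpM2l ?sqr_ge0//.
rewrite frob_sqr mxdot_self_mul sE tr_spec -SE.
exact: mxdot_quad_le.
Qed.

End Objective.

(* [r] and [z] are the square roots of [tau] and [zeta], [s ^ 2 = d ^ 2 + 2 d], [D] is
   [dim_const d] and [m] the distance between the square roots of the two covariances.
   The smallness of [alpha] only matters when [z ^ 2 < sigma]. *)
Lemma scalar_bound {R : realType} (alpha gamma sigma r z s D m : R) :
  0 < alpha -> 0 < gamma -> 0 < sigma -> 0 < r -> 0 < z -> r <= z -> 0 < s ->
  0 < D -> 6 * s <= D -> 0 <= m ->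
  sigma / 2 * m ^+ 2 + z^-1 * Num.max 0 (sigma - z ^+ 2) * m <=
    gamma * alpha * s / (2 * r ^+ 2) * m ->
  alpha <= 3 * r ^+ 3 * sigma / (gamma * z ^+ 2) * D^-1 ->
  2 * r^-1 * m <= alpha * gamma * z ^+ 2 / (3 * r ^+ 3 * sigma ^+ 2) * D.
Proof.
move=> alpha0 gamma0 sigma0 r0 z0 rz s0 D0 D6 m0 h small.
pose l := gamma * alpha * s / (2 * r ^+ 2).
have l0 : 0 < l by rewrite !divr_gt0 ?mulr_gt0 ?exprn_gt0.
suff key : m * sigma ^+ 2 <= 2 * l * z ^+ 2.
  apply: (@le_trans _ _ (2 * r^-1 * (2 * l * z ^+ 2 / sigma ^+ 2))).
    by rewrite ler_wpM2l ?mulr_ge0 ?invr_ge0 ?(ltW r0)// ler_pdivlMr ?exprn_gt0.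
  apply: (@le_trans _ _ (alpha * gamma * z ^+ 2 / (3 * r ^+ 3 * sigma ^+ 2) * (6 * s))).
    rewrite le_eqVlt; apply/orP; left; apply/eqP.
    by rewrite /l; field; rewrite !gt_eqF.
  by rewrite ler_wpM2l// divr_ge0 ?mulr_ge0 ?exprn_ge0 ?ltW.
have [->|mn0] := eqVneq m 0; first by rewrite mul0r mulr_ge0 ?sqr_ge0// mulr_ge0// ltW.
have {mn0}m0 : 0 < m by rewrite lt_neqAle eq_sym mn0.
have {}h : sigma / 2 * m + z^-1 * Num.max 0 (sigma - z ^+ 2) <= l.
  by rewrite -(ler_pM2r m0); move: h; rewrite -/l expr2 mulrA -mulrDl.
have [sz|zs] := leP sigma (z ^+ 2).
  have h1 : sigma * m <= 2 * l.
    by move: h; rewrite (max_idPl _) ?subr_le0// mulr0 addr0; lra.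
  have := ler_wpM2r (ltW sigma0) h1; rewrite mulrAC (mulrC (_ ^+ 2)) => h2.
  apply: (@le_trans _ _ (2 * l * sigma)).
    by apply: le_trans h2; rewrite le_eqVlt; apply/orP; left; apply/eqP; ring.
  by rewrite ler_wpM2l// mulr_ge0// ltW.
rewrite (max_idPr _) ?subr_ge0 ?(ltW zs)// in h.
have lz : l <= sigma / z.
  have h1 : alpha * (6 * s) <= 3 * r ^+ 3 * sigma / (gamma * z ^+ 2).
    by apply: le_trans (ler_wpM2l (ltW alpha0) D6) _; rewrite -ler_pdivlMr.
  have k0 : 0 < gamma / (12 * r ^+ 2) by rewrite divr_gt0 ?mulr_gt0 ?exprn_gt0.
  have := ler_wpM2l (ltW k0) h1.
  have -> : gamma / (12 * r ^+ 2) * (alpha * (6 * s)) = l by rewrite /l; field; rewrite gt_eqF.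
  have -> : gamma / (12 * r ^+ 2) * (3 * r ^+ 3 * sigma / (gamma * z ^+ 2)) =
      sigma / z * (r / (4 * z)) by field; rewrite !gt_eqF.
  have rz1 : r / (4 * z) <= 1 by rewrite ler_pdivrMr ?mulr_gt0// mul1r; lra.
  by move=> h2; apply: le_trans h2 _; rewrite ler_piMr// divr_ge0// ltW.
(* Multiplying [h] by sigma gives sigma^2 m / 2 <= sigma l - (sigma / z) (sigma - z^2). As l <=
   sigma / z, the right side is at most sigma l - l (sigma - z^2) = l z^2. *)
have h1 : 0 <= (sigma / z - l) * (sigma - z ^+ 2) by rewrite mulr_ge0 ?subr_ge0// ltW.
have := ler_wpM2l (ltW sigma0) h.
by move: h1; rewrite -[z^-1 * _]mulrC; move: (z ^+ 2) z^-1 => z2 zi; lra.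
Qed.

(** * Distance from a constrained minimiser to the projection *)

Section Perturbation.
Context {R : realType} {d : nat} {f : 'rV[R]_d -> R} {L sigma gamma alpha tau zeta : R}.
Hypotheses (alpha0 : 0 < alpha) (tau0 : 0 < tau) (tau_zeta : tau <= zeta).
Hypotheses (sigma0 : 0 < sigma) (gamma0 : 0 < gamma) (d0 : (0 < d)%N).
Hypotheses (fdiff : twice_differentiable f) (fsmooth : smooth L f).
Hypotheses (fconvex : strongly_convex sigma f) (fhess : lipschitz_hessian gamma f).
Implicit Types (mu v : 'rV[R]_d) (B S P : 'M[R]_d).

Let s : R := Num.sqrt (d%:R ^+ 2 + 2 * d%:R).

Let s0 : 0 < s.
Proof. by rewrite sqrtr_gt0 addr_gt0 ?exprn_gt0 ?mulr_gt0 ?ltr0n. Qed.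

(* The cubic remainder is split by [|v|^2 |v M| <= (r |v|^4 + |v M|^2 / r) / 2] with
   [r = |M| / s], which is optimal since [E |v|^4 = s^2] and [E |v M|^2 = |M|^2]. *)
Lemma Qalpha_argmin_gap mu S P : cov_set tau zeta S -> cov_set tau zeta P ->
  Qalpha f alpha mu S <= Qalpha f alpha mu P ->
  (mxdot (sqrtmx S *m hessian f mu) (sqrtmx S) - ln (\det S)) / 2
    - (mxdot (sqrtmx P *m hessian f mu) (sqrtmx P) - ln (\det P)) / 2
  <= gamma * alpha * s / (2 * tau) * frob (sqrtmx S - sqrtmx P).
Proof.
move=> Scov Pcov SP.
have Hs := hessian_sym gamma0 fdiff fhess mu.
have [V VV [k [SE SS _ _]]] := sqrtmx_cov_spec tau0 tau_zeta Scov.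
have [W WW [l [PE PP _ _]]] := sqrtmx_cov_spec tau0 tau_zeta Pcov.
have Bs : (sqrtmx S)^T = sqrtmx S by rewrite SE tr_spec.
have Cs : (sqrtmx P)^T = sqrtmx P by rewrite PE tr_spec.
rewrite -SE in SS; rewrite -PE in PP.
have incr v := increment_lower_bound gamma0 fdiff fhess mu
  (frob_sqr_cov (alpha := alpha) tau0 tau_zeta v Scov)
  (frob_sqr_cov (alpha := alpha) tau0 tau_zeta v Pcov).
move: SP Bs Cs incr {VV k SE WW l PE}; rewrite -[Qalpha _ _ _ S <= _]subr_le0.
set H := hessian f mu in Hs *; set g := gradient f mu.
set B := sqrtmx S; set C := sqrtmx P; set M := B - C => SP Bs Cs incr.
have Ms : M^T = M by rewrite /M linearB/= Bs Cs.
(* Treated apart because the weight r = |M| / s has to be positive. *)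
have [M0|M0] := eqVneq M 0.
  have BC : B = C by apply/eqP; rewrite -subr_eq0 -/M M0.
  have SPE : S = P by rewrite SS PP -/B -/C BC.
  by rewrite M0 frob0 mulr0 BC SPE subrr.
pose m := frob M; have m0 : 0 < m by rewrite lt_neqAle eq_sym frob_eq0 M0 frob_ge0.
pose r := m / s; have r0 : 0 < r by rewrite divr_gt0.
pose c := gamma * alpha ^+ 3 / (4 * tau) * r.
pose e := gamma * alpha ^+ 3 / (4 * tau) / r.
have q0 : 0 < gamma * alpha ^+ 3 / (4 * tau).
  by rewrite divr_gt0 ?mulr_gt0 ?exprn_gt0.
have c0 : 0 <= c by rewrite mulr_ge0// ltW.
pose A := (alpha ^+ 2 / 2) *: (B *m H *m B - C *m H *m C) - e *: (M *m M^T).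
have bound v : 0 + mxdot (alpha *: (g *m M)) v + mxdot (v *m A) v - c * mxdot v v ^+ 2 <=
    f (mu + alpha *: (v *m B)) - f (mu + alpha *: (v *m C)).
  apply: le_trans (incr v).
  have -> : alpha *: (v *m B) - alpha *: (v *m C) = alpha *: (v *m M).
    by rewrite -scalerBr -mulmxBr.
  have quad D : D^T = D -> mxdot ((alpha *: (v *m D)) *m H) (alpha *: (v *m D)) =
      alpha ^+ 2 * mxdot (v *m (D *m H *m D)) v.
    move=> Ds; rewrite -scalemxAl mxdotZl mxdotZr mulrA -expr2; congr (_ * _).
    by rewrite !mulmxA [RHS]mxdot_mull Ds.
  rewrite !quad// frobZ (gtr0_norm alpha0) mxdotZl mxdotZr.
  have -> : mxdot g (v *m M) = mxdot (g *m M) v by rewrite mxdot_mull Ms.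
  have -> : mxdot (v *m A) v = alpha ^+ 2 / 2 * (mxdot (v *m (B *m H *m B)) v
      - mxdot (v *m (C *m H *m C)) v) - e * frob (v *m M) ^+ 2.
    rewrite /A mulmxBr -!scalemxAr mxdotDl mxdotNl !mxdotZl mulmxBr mxdotDl mxdotNl.
    by rewrite frob_sqr mxdot_self_mul.
  have split : gamma / 2 * (alpha ^+ 2 / tau * mxdot v v) * (alpha * frob (v *m M)) <=
      c * mxdot v v ^+ 2 + e * frob (v *m M) ^+ 2.
    have -> : c * mxdot v v ^+ 2 + e * frob (v *m M) ^+ 2 =
        gamma / 2 * (alpha ^+ 2 / tau * mxdot v v) * (alpha * frob (v *m M)) +
        gamma * alpha ^+ 3 / (4 * tau) / r * (r * mxdot v v - frob (v *m M)) ^+ 2.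
      by rewrite /c /e; field; rewrite !gt_eqF.
    by rewrite lerDl mulr_ge0 ?sqr_ge0// divr_ge0// ltW.
  move: split; move: (gamma / 2 * _ * _) (c * _) (e * _) => X Y Z.
  by move: (mxdot _ _) (mxdot _ _) (mxdot _ _) => X1 X2 X3; lra.
have := Qalpha_diff_ge sigma0 d0 fdiff fsmooth fconvex c0 bound.
have trA : \tr A = alpha ^+ 2 / 2 * (mxdot (B *m H) B - mxdot (C *m H) C) - e * m ^+ 2.
  by rewrite /m frob_sqr /A [LHS]raddfB/= !mxtraceZ raddfB/= /mxdot Bs Cs.
have e1 : e * m ^+ 2 = gamma * alpha ^+ 3 / (4 * tau) * (s * m).
  by rewrite /e /r; field; rewrite !gt_eqF.
have c1 : c * (d%:R ^+ 2 + 2 * d%:R) = gamma * alpha ^+ 3 / (4 * tau) * (s * m).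
  have -> : d%:R ^+ 2 + 2 * d%:R = s ^+ 2.
    by rewrite sqr_sqrtr// addr_ge0 ?sqr_ge0 ?mulr_ge0 ?ler0n.
  by rewrite /c /r; field; rewrite !gt_eqF.
rewrite trA e1 c1 => h.
have a20 : 0 < alpha ^+ 2 by rewrite exprn_gt0.
rewrite -(ler_pM2l a20).
have -> : alpha ^+ 2 * (gamma * alpha * s / (2 * tau) * m) =
    2 * (gamma * alpha ^+ 3 / (4 * tau) * (s * m)) by field; rewrite gt_eqF.
move: (le_trans h SP) => {}h.
move: h; move: (gamma * alpha ^+ 3 / (4 * tau) * (s * m)) (alpha ^+ 2) => X a2.
by move: (ln _) (ln _) (mxdot _ _) (mxdot _ _) => *; lra.
Qed.

(** The growth of the model bounds the energy gap from below, the remainder bounds it from above.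
    Only minimality in the covariance at the given [mu] enters, so the result serves for both
    Sigmahat and Sigmastar. *)
Lemma argmin_proj_dist mu S : cov_set tau zeta S ->
  (forall X, cov_set tau zeta X -> Qalpha f alpha mu S <= Qalpha f alpha mu X) ->
  alpha <= 3 * tau `^ (3 / 2) * sigma / (gamma * zeta) * (dim_const d)^-1 ->
  frob (S - proj_cov tau zeta (invmx (hessian f mu))) <=
    alpha * gamma * zeta / (3 * tau `^ (3 / 2) * sigma ^+ 2) * dim_const d.
Proof.
move=> Scov Smin; set D := dim_const d.
have D6 : 6 * s <= D by exact: dim_const_ge.
have D0 : 0 < D by apply: lt_le_trans D6; rewrite mulr_gt0.
have Hs := hessian_sym gamma0 fdiff fhess mu.
have Hge := hessian_ge gamma0 fdiff fconvex fhess mu.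
have Hinv : (invmx (hessian f mu))^T = invmx (hessian f mu) by rewrite trmx_inv Hs.
have [Pcov _] := proj_covP tau0 tau_zeta Hinv.
set P := proj_cov _ _ _ in Pcov *.
have gap := Qalpha_argmin_gap Scov Pcov (Smin P Pcov).
have low := sqrtmx_energy_gap tau0 tau_zeta Hs sigma0 Hge Scov (erefl P).
have [V VV [k [SE SS _ _]]] := sqrtmx_cov_spec tau0 tau_zeta Scov.
have [W WW [l [PE PP _ _]]] := sqrtmx_cov_spec tau0 tau_zeta Pcov.
have Bs : (sqrtmx S)^T = sqrtmx S by rewrite SE tr_spec.
have Cs : (sqrtmx P)^T = sqrtmx P by rewrite PE tr_spec.
rewrite -SE in SS; rewrite -PE in PP.
have rt0 : 0 < Num.sqrt tau by rewrite sqrtr_gt0.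
have rz0 : 0 < Num.sqrt zeta by rewrite sqrtr_gt0 (lt_le_trans tau0).
have ti0 : 0 <= tau^-1 by rewrite invr_ge0 ltW.
have dist : frob (S - P) <= 2 * (Num.sqrt tau)^-1 * frob (sqrtmx S - sqrtmx P).
  have cc : (Num.sqrt tau)^-1 ^+ 2 = tau^-1 by rewrite exprVn sqr_sqrtr// ltW.
  rewrite {1}SS {1}PP; apply: frob_sqrB_le => //; rewrite ?cc -?SS -?PP ?invr_ge0 ?ltW//.
  - by have [] := Scov.
  - by have [] := Pcov.
move=> small; apply: (le_trans dist).
rewrite powR32 ?(ltW tau0)// in small *.
have [zE tE] : zeta = Num.sqrt zeta ^+ 2 /\ tau = Num.sqrt tau ^+ 2.
  by rewrite !sqr_sqrtr// ltW// (lt_le_trans tau0).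
have rz : Num.sqrt tau <= Num.sqrt zeta by exact: ler_wsqrtr.
move: small; rewrite zE => small; apply: (scalar_bound (s := s)) small => //.
- exact: frob_ge0.
- move: low gap; rewrite sqrtrV ?(le_trans (ltW tau0))// -zE -tE.
  by move: (frob _) (_ / 2) (_ / 2) => *; lra.
Qed.

End Perturbation.

(** * Distance between the two locations *)

Section Location.
Context {R : realType} {d : nat} {f : 'rV[R]_d -> R} {L sigma gamma alpha tau zeta : R}.
Hypotheses (alpha0 : 0 < alpha) (tau0 : 0 < tau) (tau_zeta : tau <= zeta).
Hypotheses (sigma0 : 0 < sigma) (d0 : (0 < d)%N).
Hypotheses (fdiff : twice_differentiable f) (fsmooth : smooth L f).
Hypotheses (fconvex : strongly_convex sigma f).

(** The expectation at [mu] is at least f(mu) by convexity, the one at [nu] at most f(nu) + L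
    alpha^2 tr S since the gradient vanishes there, and tr S <= d / tau. Strong convexity at [nu]
    turns the resulting bound on f(mu) - f(nu) into a distance. *)
Lemma argmin_location_dist mu nu S : cov_set tau zeta S ->
  minimizer setT f nu -> Qalpha f alpha mu S <= Qalpha f alpha nu S ->
  frob (mu - nu) ^+ 2 <= 2 * d%:R * L * alpha ^+ 2 / (sigma * tau).
Proof.
move=> Scov numin Qle.
have gnu := minimizer_gradient sigma0 fsmooth fconvex numin.
have L0 := smooth_ge0 d0 fsmooth.
have [V VV [k [SE SS _ _]]] := sqrtmx_cov_spec tau0 tau_zeta Scov.
have Bs : (sqrtmx S)^T = sqrtmx S by rewrite SE tr_spec.
rewrite -SE in SS; set B := sqrtmx S in Bs SS.
have trS : mxdot B B <= d%:R / tau.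
  have [Ss _ Sle] := Scov.
  have := mxdot_quad_le (1%:M : 'M[R]_d) Ss Sle.
  rewrite mul1mx /mxdot trmx1 !mulmx1 mxtrace1 Bs -SS.
  by rewrite mulrC.
pose A : 'M[R]_d := (- (L * alpha ^+ 2)) *: (B *m B^T).
have bound v : (f mu - f nu) + mxdot (alpha *: (gradient f mu *m B)) v
    + mxdot (v *m A) v - 0 * mxdot v v ^+ 2 <=
    f (mu + alpha *: (v *m B)) - f (nu + alpha *: (v *m B)).
  have lo := convex_lower_bound fconvex mu (alpha *: (v *m B)).
  have up := convex_upper_bound sigma0 fsmooth fconvex nu (alpha *: (v *m B)).
  have -> : mxdot (alpha *: (gradient f mu *m B)) v =
      mxdot (gradient f mu) (alpha *: (v *m B)).
    by rewrite mxdotZl mxdotZr mxdot_mull Bs.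
  have -> : mxdot (v *m A) v = - (L * frob (alpha *: (v *m B)) ^+ 2).
    rewrite /A -scalemxAr mxdotZl -mxdot_self_mul frobZ exprMn frob_sqr.
    by rewrite real_normK ?num_real//; ring.
  rewrite gnu mxdot0l addr0 in up.
  have s0 : 0 <= sigma / 2 * frob (alpha *: (v *m B)) ^+ 2.
    by rewrite mulr_ge0 ?sqr_ge0// divr_ge0// ltW.
  move: lo up s0; move: (sigma / 2 * _) (L * _) (mxdot (gradient f mu) _) => X Y Z.
  by move: (f _) (f _) (f _) (f _) => a b c e; lra.
have := Qalpha_diff_ge sigma0 d0 fdiff fsmooth fconvex (lexx 0) bound.
rewrite subrr mulr0 subr0 mul0r subr0.
have -> : \tr A = - (L * alpha ^+ 2 * mxdot B B) by rewrite /A mxtraceZ mulNr.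
move=> h; have h1 : f mu - f nu <= L * alpha ^+ 2 * (d%:R / tau).
  have : L * alpha ^+ 2 * mxdot B B <= L * alpha ^+ 2 * (d%:R / tau).
    by rewrite ler_wpM2l// mulr_ge0// sqr_ge0.
  by move: h Qle; move: (Qalpha _ _ _ _) (Qalpha _ _ _ _) (L * _ * _) (L * _ * _) => *; lra.
have := convex_lower_bound fconvex nu (mu - nu).
rewrite gnu mxdot0l addr0 (_ : nu + (mu - nu) = mu) => [h2|]; last by rewrite addrC subrK.
have -> : 2 * d%:R * L * alpha ^+ 2 / (sigma * tau) =
    2 / sigma * (L * alpha ^+ 2 * (d%:R / tau)) by field; rewrite !gt_eqF.
have h3 : sigma / 2 * frob (mu - nu) ^+ 2 <= L * alpha ^+ 2 * (d%:R / tau).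
  by move: h1 h2; move: (f _) (f _) (_ / 2 * _) (L * _ * _) => *; lra.
have k0 : 0 <= 2 / sigma by rewrite divr_ge0// ltW.
have := ler_wpM2l k0 h3; rewrite mulrA.
have -> : 2 / sigma * (sigma / 2) = 1 by field; rewrite gt_eqF.
by rewrite mul1r.
Qed.

End Location.

(** * Combination of the estimates *)

Lemma frob_path {R : realType} m n (A B C D : 'M[R]_(m, n)) :
  frob (A - B) <= frob (A - C) + frob (C - D) + frob (D - B).
Proof.
have -> : A - B = (A - C) + (C - D) + (D - B).
  by apply/matrixP => i j; rewrite !mxE; ring.
by apply: le_trans (frobD _ _) _; rewrite lerD2r frobD.
Qed.

Theorem theorem4 (R : realType) (d : nat) (hd : (0 < d)%N)
    (alpha tau zeta : R) (halpha : 0 < alpha) (htau : 0 < tau)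
    (hzeta : tau <= zeta)
    (L sigma gamma : R) (hsigma : 0 < sigma) (hgamma : 0 < gamma)
    (f : 'rV[R]_d -> R)
    (hdiff : twice_differentiable f)
    (hsmooth : smooth L f)
    (hconvex : strongly_convex sigma f)
    (hhess : lipschitz_hessian gamma f)
    (muhat : 'rV[R]_d) (Sigmahat : 'M[R]_d)
    (hhat : minimizer [set p : 'rV[R]_d * 'M[R]_d | cov_set tau zeta p.2]
              (fun p => Qalpha f alpha p.1 p.2) (muhat, Sigmahat))
    (mustar : 'rV[R]_d) (hmustar : minimizer [set: 'rV[R]_d] f mustar)
    (Sigmastar : 'M[R]_d)
    (hSigmastar : minimizer (cov_set tau zeta) (Qalpha f alpha mustar) Sigmastar)
    (hsmall : alpha <= 3 * tau `^ (3 / 2) * sigma / (gamma * zeta)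
                       * (dim_const d)^-1) :
  frob (Sigmahat - proj_cov tau zeta (invmx (hessian f muhat)))
    <= alpha * gamma * zeta / (3 * tau `^ (3 / 2) * sigma ^+ 2) * dim_const d
  /\
  frob (Sigmastar - Sigmahat)
    <= 2 * alpha * gamma * zeta / (3 * tau `^ (3 / 2) * sigma ^+ 2) * dim_const d
       + gamma / sigma ^+ 2 *
         (2 * d%:R * L * alpha ^+ 2 / (sigma * tau)
          + 2 * gamma * alpha ^+ 3 * (d%:R ^+ 2 + 2 * d%:R) `^ (3 / 4)
            / (3 * sigma * tau `^ (3 / 2))
          + d%:R * alpha ^+ 2 / sigma * (tau^-1 - zeta^-1)) `^ (1 / 2).
Proof.
have [/= hatcov hatmin] := hhat; have [starcov starmin] := hSigmastar.
have hatmin_Sigma X (hX : cov_set tau zeta X) :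
  Qalpha f alpha muhat Sigmahat <= Qalpha f alpha muhat X := hatmin (muhat, X) hX.
have hatmin_mu : Qalpha f alpha muhat Sigmahat <= Qalpha f alpha mustar Sigmahat :=
  hatmin (mustar, Sigmahat) hatcov.
have hat_dist := argmin_proj_dist halpha htau hzeta hsigma hgamma hd hdiff hsmooth
  hconvex hhess hatcov hatmin_Sigma hsmall.
have star_dist := argmin_proj_dist halpha htau hzeta hsigma hgamma hd hdiff hsmooth
  hconvex hhess starcov starmin hsmall.
split; first exact: hat_dist.
have Hs mu := hessian_sym hgamma hdiff hhess mu.
have Hge mu := hessian_ge hgamma hdiff hconvex hhess mu.
set Ph := proj_cov _ _ _ in hat_dist.
set Ps := proj_cov _ _ _ in star_dist.
set bnd := _ * dim_const d in hat_dist star_dist.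
have proj_dist : frob (Ps - Ph) <= gamma / sigma ^+ 2 * frob (muhat - mustar).
  apply: le_trans (proj_cov_nonexpansive htau hzeta _ _) _; rewrite ?trmx_inv ?Hs//.
  apply: le_trans (frob_invmxB_le (Hs _) (Hs _) hsigma (Hge _) (Hge _)) _.
  rewrite mulrAC ler_pM2r ?invr_gt0 ?exprn_gt0// (frobBC muhat).
  exact: hhess.
have loc := argmin_location_dist htau hzeta hsigma hd hdiff hsmooth hconvex
  hatcov hmustar hatmin_mu.
set W := (X in X `^ (1 / 2)).
(* The location bound is the first summand of [W]; the other two are nonnegative. *)
have WE : frob (muhat - mustar) ^+ 2 <= W.
  apply: le_trans loc _; rewrite /W -addrA lerDl addr_ge0//.
    rewrite divr_ge0 ?mulr_ge0 ?exprn_ge0 ?powR_ge0 ?ltW//.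
  apply: mulr_ge0; first by rewrite divr_ge0 ?mulr_ge0 ?sqr_ge0// ltW.
  by rewrite subr_ge0 lef_pV2 ?posrE// (lt_le_trans htau).
have mu_dist : frob (muhat - mustar) <= W `^ (1 / 2).
  rewrite div1r powR12_sqrt ?(le_trans (sqr_ge0 _) WE)//.
  by rewrite -[leLHS]ger0_norm ?frob_ge0// -sqrtr_sqr ler_wsqrtr.
have gs : 0 <= gamma / sigma ^+ 2 by rewrite divr_ge0 ?sqr_ge0 ?ltW.
have -> : 2 * alpha * gamma * zeta / (3 * tau `^ (3 / 2) * sigma ^+ 2) * dim_const d =
  bnd + bnd by rewrite /bnd; ring.
clearbody Ph Ps bnd W.
(* Path from Sigmastar through the two projections to Sigmahat: each outer leg costs one [bnd], the
   middle one is [proj_dist]. *)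
apply: le_trans (frob_path _ _ Ps Ph) _.
rewrite (frobBC Ph) addrAC; apply: lerD; first exact: lerD.
exact: le_trans proj_dist (ler_wpM2l gs mu_dist).
Qed.
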